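(* Let $R$ be a commutative noetherian ring and let $\mathcal{X}$ be a KE-closed subcategory of $\mathsf{mod}\,R$. Then $$\mathcal{X}=\mathsf{mod}^{\mathrm{ass}}_{A^0(\mathcal{X})}R\,\cap\,\mathsf{mod}^1_{A^1(\mathcal{X})}R .$$
   Context: $\mathsf{mod}\,R$ is the category of finitely generated $R$-modules. All subcategories are full and closed under isomorphisms. An additive subcategory (closed under finite direct sums, hence containing $0$) is KE-closed if it is closed under extensions and under kernels of morphisms between its objects. Depth of a finitely generated module over a noetherian local ring with residue field $k$ is $\inf\{n\ge0\mid\operatorname{Ext}^n(k,M)\neq0\}$, with $\operatorname{depth}0=\infty$. For $n\ge 0$ and $M\in\mathsf{mod}\,R$ put $A^n(M)=\{\mathfrak p\in\operatorname{Spec}R\mid\operatorname{depth}_{R_{\mathfrak p}}M_{\mathfrak p}\le n\}$; for a subcategory $\mathcal{X}$ put $A^n(\mathcal{X})=\bigcup_{X\in\mathcal{X}}A^n(X)$; for $\Phi\subseteq\operatorname{Spec}R$ put $\mathsf{mod}^n_\Phi R=\{M\in\mathsf{mod}\,R\mid A^n(M)\subseteq\Phi\}$. Also $\mathsf{mod}^{\mathrm{ass}}_\Phi R=\{M\in\mathsf{mod}\,R\mid\operatorname{Ass}M\subseteq\Phi\}$ (which equals $\mathsf{mod}^0_\Phi R$). *)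

(* Defs.v *)
From HB Require Import structures.
From mathcomp Require Import all_boot all_algebra ring.
From mathcomp Require Import boolp.

Set Implicit Arguments.
Unset Strict Implicit.
Unset Printing Implicit Defensive.

Import GRing.Theory.
Local Open Scope ring_scope.
Local Open Scope quotient_scope.

(* The base ring is a [comPzRingType], so that the zero ring is allowed.  The
   ideals of [ring_quotient] live in nonzero rings and are always proper, which
   is why ideals and primes are redefined here. *)

Definition ideal (R : comPzRingType) (I : {pred R}) : Prop :=
  [/\ 0 \in I, {in I &, forall u v, u + v \in I}
    & forall a, {in I, forall u, a * u \in I}].

Definition prime_ideal (R : comPzRingType) (p : {pred R}) : Prop :=
  [/\ ideal p, 1 \notin p
    & forall u v, u * v \in p -> u \in p \/ v \in p].

Record spec (R : comPzRingType) := Spec {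
  spec_pred :> {pred R};
  specP : prime_ideal spec_pred
}.

Definition noetherian (R : comPzRingType) : Prop :=
  forall I : {pred R}, ideal I ->
    exists (n : nat) (g : 'I_n -> R), (forall i, g i \in I) /\
      forall x, x \in I -> exists c : 'I_n -> R, x = \sum_(i < n) c i * g i.

Definition fin_gen (R : pzRingType) (M : lmodType R) : Prop :=
  exists (n : nat) (g : 'I_n -> M),
    forall x, exists c : 'I_n -> R, x = \sum_(i < n) c i *: g i.

Section Denominators.
Variables (R : comPzRingType) (p : spec R).

Definition denom := {s : R | s \notin p}.

Lemma denomM_subproof (s t : denom) : sval s * sval t \notin p.
Proof.
by case: (specP p) => _ _ pM; apply/negP => /pM [];
  [apply/negP/(valP s) | apply/negP/(valP t)].
Qed.

Lemma denom1_subproof : 1 \notin p. Proof. by case: (specP p). Qed.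

Definition denomM (s t : denom) : denom :=
  exist _ (sval s * sval t) (denomM_subproof s t).
Definition denom1 : denom := exist _ 1 denom1_subproof.

End Denominators.

Arguments denom1 {R p}.

Section LocalizedModule.
Variables (R : comPzRingType) (p : spec R) (M : lmodType R).
Implicit Types (x y z : M * denom p).

(* the pair [(m, s)] stands for the fraction [m / s] *)
Definition frac_equiv x y : bool :=
  `[< exists u : denom p,
        (sval u * sval y.2) *: x.1 = (sval u * sval x.2) *: y.1 >].

Lemma frac_equiv_is_equiv : equiv_class_of frac_equiv.
Proof.
split=> [x|x y|y x z].
- by apply/asboolP; exists denom1.
- by apply/asboolP/asboolP => -[u e]; exists u.
move=> /asboolP[u eu] /asboolP[v ev]; apply/asboolP.
exists (denomM (denomM u v) y.2) => /=.
transitivity ((sval v * sval z.2) *: ((sval u * sval y.2) *: x.1)).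
  by rewrite scalerA; congr (_ *: _); ring.
rewrite eu; transitivity ((sval u * sval x.2) *: ((sval v * sval z.2) *: y.1)).
  by rewrite !scalerA; congr (_ *: _); ring.
by rewrite ev scalerA; congr (_ *: _); ring.
Qed.

Canonical frac_equiv_equiv := EquivRelPack frac_equiv_is_equiv.
Canonical frac_equiv_encModRel := defaultEncModRel frac_equiv.

Definition loc_mod := {eq_quot frac_equiv}.
HB.instance Definition _ : EqQuotient _ frac_equiv loc_mod :=
  EqQuotient.on loc_mod.
HB.instance Definition _ := Choice.on loc_mod.

Definition loc_frac (m : M) (s : denom p) : loc_mod := \pi_loc_mod (m, s).

Lemma loc_fracP m s n t :
  loc_frac m s = loc_frac n t <->
  exists u : denom p, (sval u * sval t) *: m = (sval u * sval s) *: n.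
Proof.
split=> [/eqmodP/asboolP //|e]; exact/eqmodP/asboolP.
Qed.

Lemma loc_fracW (P : loc_mod -> Prop) :
  (forall m s, P (loc_frac m s)) -> forall q, P q.
Proof. by move=> h; apply: quotW => -[m s]; apply: h. Qed.

Lemma loc_frac_repr (x : loc_mod) : loc_frac (repr x).1 (repr x).2 = x.
Proof. by rewrite /loc_frac -surjective_pairing reprK. Qed.

(* The operations are locked so that unification does not expand them; use the
   lemmas computing them on fractions. *)
Definition loc_zero := loc_frac 0 denom1.
Definition loc_opp := locked (fun x : loc_mod =>
  loc_frac (- (repr x).1) (repr x).2).
Definition loc_add := locked (fun x y : loc_mod =>
  loc_frac (sval (repr y).2 *: (repr x).1 + sval (repr x).2 *: (repr y).1)
           (denomM (repr x).2 (repr y).2)).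

Lemma loc_oppE m s : loc_opp (loc_frac m s) = loc_frac (- m) s.
Proof.
rewrite /loc_opp; unlock.
have /loc_fracP[u e] := loc_frac_repr (loc_frac m s).
by apply/loc_fracP; exists u; rewrite !scalerN e.
Qed.

Lemma loc_addE m s n t : loc_add (loc_frac m s) (loc_frac n t) =
  loc_frac (sval t *: m + sval s *: n) (denomM s t).
Proof.
rewrite /loc_add; unlock.
have /loc_fracP[u] := loc_frac_repr (loc_frac m s).
have /loc_fracP[v] := loc_frac_repr (loc_frac n t).
case: (repr _) => n' t'; case: (repr _) => m' s' /= ev eu.
apply/loc_fracP; exists (denomM u v); rewrite /= !scalerDr !scalerA.
congr (_ + _).
  transitivity ((sval v * sval t * sval t') *: ((sval u * sval s) *: m')).
    by rewrite scalerA; congr (_ *: _); ring.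
  by rewrite eu scalerA; congr (_ *: _); ring.
transitivity ((sval u * sval s * sval s') *: ((sval v * sval t) *: n')).
  by rewrite scalerA; congr (_ *: _); ring.
by rewrite ev scalerA; congr (_ *: _); ring.
Qed.

Lemma loc_addA : associative loc_add.
Proof.
elim/loc_fracW=> a r; elim/loc_fracW=> b s; elim/loc_fracW=> c t.
rewrite !loc_addE; apply/loc_fracP; exists denom1.
rewrite /= !scalerDr !scalerA addrA.
by congr (_ *: _ + _ *: _ + _ *: _); ring.
Qed.

Lemma loc_addC : commutative loc_add.
Proof.
elim/loc_fracW=> a r; elim/loc_fracW=> b s.
rewrite !loc_addE addrC; apply/loc_fracP; exists denom1.
by congr (_ *: _) => /=; ring.
Qed.

Lemma loc_add0 : left_id loc_zero loc_add.
Proof.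
elim/loc_fracW=> a r; rewrite loc_addE scaler0 add0r.
by apply/loc_fracP; exists denom1; rewrite /= scalerA; congr (_ *: _); ring.
Qed.

Lemma loc_addN : left_inverse loc_zero loc_opp loc_add.
Proof.
elim/loc_fracW=> a r; rewrite loc_oppE loc_addE scalerN addNr.
by apply/loc_fracP; exists denom1; rewrite !scaler0.
Qed.

HB.instance Definition _ :=
  GRing.isZmodule.Build loc_mod loc_addA loc_addC loc_add0 loc_addN.

Lemma loc_fracD m s n t : loc_frac m s + loc_frac n t =
  loc_frac (sval t *: m + sval s *: n) (denomM s t).
Proof. exact: loc_addE. Qed.

End LocalizedModule.

Arguments loc_mod {R} p M.
Arguments loc_frac {R p M} m s.

Section LocalizedRing.
Variables (R : comPzRingType) (p : spec R).

Lemma regular_scaleE (a b : R) : a *: (b : R^o) = a * b. Proof. by []. Qed.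

Section Scale.
Variable M : lmodType R.

Definition loc_scale : loc_mod p R^o -> loc_mod p M -> loc_mod p M :=
  locked (fun a x =>
    loc_frac (((repr a).1 : R) *: (repr x).1) (denomM (repr a).2 (repr x).2)).

Lemma loc_scaleE (a : R) s (m : M) t :
  loc_scale (loc_frac (a : R^o) s) (loc_frac m t) =
  loc_frac (a *: m) (denomM s t).
Proof.
rewrite /loc_scale; unlock.
have /loc_fracP[u] := loc_frac_repr (loc_frac (a : R^o) s).
have /loc_fracP[v] := loc_frac_repr (loc_frac m t).
case: (repr _) => m' t'; case: (repr _) => a' s' /= ev eu.
have {}eu : sval u * sval s * a' = sval u * sval s' * a by [].
apply/loc_fracP; exists (denomM u v); rewrite /= !scalerA.
transitivity ((sval u * sval s * a') *: ((sval v * sval t) *: m')).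
  by rewrite scalerA; congr (_ *: _); ring.
by rewrite ev eu scalerA; congr (_ *: _); ring.
Qed.

Lemma loc_scaleDr a : {morph loc_scale a : x y / x + y}.
Proof.
elim/loc_fracW: a => a s; elim/loc_fracW=> m t; elim/loc_fracW=> n r.
rewrite loc_fracD !loc_scaleE loc_fracD; apply/loc_fracP; exists denom1.
rewrite /= !scalerDr !scalerA.
by congr (_ *: _ + _ *: _); ring.
Qed.

Lemma loc_scaleDl x : {morph loc_scale^~ x : a b / a + b}.
Proof.
elim/loc_fracW: x => m t; elim/loc_fracW=> a s; elim/loc_fracW=> b r.
rewrite loc_fracD !loc_scaleE loc_fracD; apply/loc_fracP; exists denom1.
rewrite /= !regular_scaleE [in LHS]scalerDl !scalerDr !scalerA.
by congr (_ *: _ + _ *: _); ring.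
Qed.

Lemma loc_scale1 : left_id (loc_frac (1 : R^o) denom1) loc_scale.
Proof.
elim/loc_fracW=> m t; rewrite loc_scaleE.
by apply/loc_fracP; exists denom1; rewrite /= scale1r; congr (_ *: _); ring.
Qed.

End Scale.

Definition loc_ring := loc_mod p R^o.
HB.instance Definition _ := GRing.Zmodule.on loc_ring.

Definition loc_mul : loc_ring -> loc_ring -> loc_ring := @loc_scale R^o.

Lemma loc_scaleA (M : lmodType R) a b (x : loc_mod p M) :
  loc_scale a (loc_scale b x) = loc_scale (loc_mul a b) x.
Proof.
elim/loc_fracW: x => m t; elim/loc_fracW: a => a s; elim/loc_fracW: b => b r.
rewrite /loc_mul !loc_scaleE.
apply/loc_fracP; exists denom1.
by rewrite /= !scalerA regular_scaleE; congr (_ *: _); ring.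
Qed.

Lemma loc_mulA : associative loc_mul.
Proof. by move=> a b c; apply: loc_scaleA. Qed.

Lemma loc_mulC : commutative loc_mul.
Proof.
elim/loc_fracW=> a s; elim/loc_fracW=> b t.
rewrite /loc_mul !loc_scaleE; apply/loc_fracP; exists denom1.
by rewrite /= !regular_scaleE; ring.
Qed.

Lemma loc_mul1 : left_id (loc_frac (1 : R^o) denom1 : loc_ring) loc_mul.
Proof. exact: loc_scale1. Qed.

Lemma loc_mulDl : left_distributive loc_mul +%R.
Proof. by move=> a b c; apply: loc_scaleDl. Qed.

Lemma loc_one_neq0 : (loc_frac (1 : R^o) denom1 : loc_ring) != 0.
Proof.
apply/eqP => /loc_fracP[u]; rewrite /= scaler0 regular_scaleE !mulr1 => u0.
by case: (specP p) => -[p0 _ _] _ _; have := svalP u; rewrite u0 p0.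
Qed.

HB.instance Definition _ := GRing.Zmodule_isComNzRing.Build loc_ring
  loc_mulA loc_mulC loc_mul1 loc_mulDl loc_one_neq0.

Definition loc_ring_frac (a : R) (s : denom p) : loc_ring :=
  loc_frac (a : R^o) s.

HB.instance Definition _ (M : lmodType R) :=
  GRing.Zmodule_isLmodule.Build loc_ring (loc_mod p M)
    (@loc_scaleA M) (@loc_scale1 M) (@loc_scaleDr M) (@loc_scaleDl M).

(* [p R_p]; all other elements are units, see [loc_max_unit] *)
Definition loc_max : {pred loc_ring} :=
  fun x => `[< exists a s, a \in p /\ x = loc_ring_frac a s >].

Lemma loc_max_frac a s : (loc_ring_frac a s \in loc_max) = (a \in p).
Proof.
apply/asboolP/idP => [[b [t [bp /loc_fracP[u e]]]]|ap]; last by exists a, s.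
case: (specP p) => -[_ _ pZ] _ pM.
have {}e : sval u * sval t * a = sval u * sval s * b by [].
have /pM[|//] : sval u * sval t * a \in p by rewrite e; apply: pZ.
by move/pM => []; [have := valP u | have := valP t] => /negP.
Qed.

Lemma loc_max_idealr : idealr_closed loc_max.
Proof.
case: (specP p) => -[p0 pD pZ] p1 _; split.
- exact/asboolP/(ex_intro _ 0)/(ex_intro _ denom1).
- by rewrite (loc_max_frac 1 denom1).
elim/loc_fracW=> a s; elim/loc_fracW=> b t; elim/loc_fracW=> c r.
rewrite !loc_max_frac => bp cp.
rewrite [_ * _]loc_scaleE [_ + _]loc_fracD loc_max_frac.
by apply: pD; apply: (pZ) => //; apply: (pZ).
Qed.

HB.instance Definition _ := isIdealr.Build loc_ring loc_max loc_max_idealr.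

Lemma loc_max_unit (x : loc_ring) : x \notin loc_max -> exists y, y * x = 1.
Proof.
elim/loc_fracW: x => a s; rewrite loc_max_frac => ap.
exists (loc_ring_frac (sval s) (exist _ a ap)).
rewrite [_ * _]loc_scaleE; apply/loc_fracP; exists denom1.
by rewrite /= !regular_scaleE; ring.
Qed.

End LocalizedRing.

Arguments loc_max {R} p _.

Definition residue (S : comNzRingType) (m : idealr S) := {ideal_quot m}.

Section Residue.
Variables (S : comNzRingType) (m : idealr S).
Local Notation k := (residue m).

HB.instance Definition _ := GRing.ComNzRing.on k.

Definition residue_scale (a : S) (x : k) : k := \pi_{ideal_quot m} a * x.

Fact residue_scaleA a b x :
  residue_scale a (residue_scale b x) = residue_scale (a * b) x.
Proof. by rewrite /residue_scale mulrA -rmorphM. Qed.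
Fact residue_scale1 : left_id 1 residue_scale.
Proof. by move=> x; rewrite /residue_scale rmorph1 mul1r. Qed.
Fact residue_scaleDr : right_distributive residue_scale +%R.
Proof. by move=> a x y; rewrite /residue_scale mulrDr. Qed.
Fact residue_scaleDl x : {morph residue_scale^~ x : a b / a + b}.
Proof. by move=> a b; rewrite /residue_scale rmorphD mulrDl. Qed.

HB.instance Definition _ := GRing.Zmodule_isLmodule.Build S k
  residue_scaleA residue_scale1 residue_scaleDr residue_scaleDl.

End Residue.

Section Ext.
Variable S : pzRingType.

Definition projective (P : lmodType S) : Prop :=
  forall (A B : lmodType S) (g : {linear A -> B}) (f : {linear P -> B}),
    (forall b, exists a, g a = b) ->
    exists h : {linear P -> A}, forall x, g (h x) = f x.

Record proj_resolution (K : lmodType S) := ProjResolution {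
  res_obj :> nat -> lmodType S;
  res_diff : forall n, {linear res_obj n.+1 -> res_obj n};
  res_aug : {linear res_obj 0 -> K};
  res_proj : forall n, projective (res_obj n);
  res_aug_surj : forall y, exists x, res_aug x = y;
  res_exact0 : forall x, res_aug x = 0 <-> exists z, res_diff 0 z = x;
  res_exact : forall n x,
    res_diff n x = 0 <-> exists z, res_diff n.+1 z = x
}.

Section Cohomology.
Variables (K : lmodType S) (P : proj_resolution K) (M : lmodType S).

Definition ext_cocycle n (f : {linear P n -> M}) : Prop :=
  forall x, f (res_diff P n x) = 0.

Definition ext_coboundary n : {linear P n -> M} -> Prop :=
  match n with
  | 0 => fun f => forall x, f x = 0
  | n'.+1 => fun f => exists g : {linear P n' -> M},
                        forall x, f x = g (res_diff P n' x)
  end.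

End Cohomology.

(* Ext^n(K, M) <> 0, i.e. H^n(Hom(P, M)) <> 0 for a projective resolution P of
   K; up to isomorphism this cohomology does not depend on P. *)
Definition ext_neq0 (n : nat) (K M : lmodType S) : Prop :=
  exists (P : proj_resolution K) (f : {linear P n -> M}),
    ext_cocycle f /\ ~ ext_coboundary f.

End Ext.

(* For [m] the maximal ideal of a local ring [S]; [None] stands for infinity,
   the infimum of the empty set. *)
Definition depth (S : comNzRingType) (m : idealr S) (M : lmodType S)
    : option nat :=
  if pselect (exists n, `[< ext_neq0 n (residue m) M >]) is left e
  then Some (ex_minn e) else None.

Definition depth_le (d : option nat) (n : nat) : bool :=
  if d is Some i then (i <= n)%N else false.

Section Subcategories.
Variable R : comPzRingType.

(* A full subcategory is given by its class of objects. *)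
Definition mod_class := lmodType R -> Prop.

Definition strict_subcategory (X : mod_class) : Prop :=
  (forall M, X M -> fin_gen M) /\
  (forall (M N : lmodType R) (f : {linear M -> N}),
     bijective f -> X M -> X N).

Definition additive_closed (X : mod_class) : Prop :=
  (forall Z : lmodType R, (forall z : Z, z = 0) -> X Z) /\
  (forall M N : lmodType R, X M -> X N -> X (M * N)%type).

Definition extension_closed (X : mod_class) : Prop :=
  forall (A B C : lmodType R) (f : {linear A -> B}) (g : {linear B -> C}),
    injective f -> (forall c, exists b, g b = c) ->
    (forall b, g b = 0 <-> exists a, f a = b) ->
    X A -> X C -> X B.

Definition kernel_closed (X : mod_class) : Prop :=
  forall (A B K : lmodType R) (f : {linear A -> B}) (i : {linear K -> A}),
    injective i -> (forall a, f a = 0 <-> exists k, i k = a) ->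
    X A -> X B -> X K.

Definition KE_closed (X : mod_class) : Prop :=
  [/\ strict_subcategory X, additive_closed X, extension_closed X
    & kernel_closed X].

Definition Ass (M : lmodType R) (p : spec R) : Prop :=
  exists m : M, forall r, r \in p <-> r *: m = 0.

Definition A_mod (n : nat) (M : lmodType R) (p : spec R) : Prop :=
  depth_le (depth (loc_max p) (loc_mod p M)) n.

Definition A_class (n : nat) (X : mod_class) (p : spec R) : Prop :=
  exists M, X M /\ A_mod n M p.

Definition mod_depth (n : nat) (Phi : spec R -> Prop) : mod_class :=
  fun M => fin_gen M /\ forall p, A_mod n M p -> Phi p.

Definition mod_ass (Phi : spec R -> Prop) : mod_class :=
  fun M => fin_gen M /\ forall p, Ass M p -> Phi p.

End Subcategories.

(* Main.v *)
(** Call a module C a target if the kernel of every map N -> C with N in X lies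
in X.  Targets are closed under submodules and extensions, so a finitely
generated C is a target as soon as every prime of Ass C is associated to some
target.  They contain X and, more importantly, the cokernel of every injection
A -> B in X: if C = B / A and f : N -> C, the fibre product of N and B over C is
an extension of N by A, and ker f is the kernel of its projection to B.

A prime p with depth X_p = 1 for some X in the class is associated to a
target.  Indeed some L in the class has Hom(R/p, L) = 0 and L_p = X_p; then
L -> Hom(p, L) is injective with cokernel Ext^1(R/p, L), of which p is an
associated prime.  Finally, a finitely generated M with Ass M in A^0(X) embeds
into some N in X, and the primes of Ass(N/M) lie in A^0(X) or in A^1(M); so if A^1(M)
is contained in A^1(X), then N/M is a target and M, the kernel of N -> N/M,
lies in X. *)

From HB Require Import structures.
Require Import Defs.
From mathcomp Require Import all_boot all_algebra ring.
From mathcomp Require Import boolp.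

Set Implicit Arguments.
Unset Strict Implicit.
Unset Printing Implicit Defensive.

Import GRing.Theory.
Local Open Scope ring_scope.

(** * Submodules and quotient modules *)

Section Submodules.
Variables (R : pzRingType) (M : lmodType R).

(** Submodules are boolean predicates; classical reflection turns any closed predicate into one.
    Kernels, images and sums are all built this way. *)
Lemma submod_ex (P : M -> Prop) :
    P 0 -> (forall a x y, P x -> P y -> P (a *: x + y)) ->
  exists U : submodClosed M, forall x, x \in U <-> P x.
Proof.
move=> P0 PD; pose S : M -> bool := fun x => `[< P x >].
have h : subsemimod_closed S.
  apply: GRing.submod_closed_semi; split; first exact/asboolP.
  by move=> a x y /asboolP Px /asboolP Py; apply/asboolP/PD.
by exists (HB.pack_for (submodClosed M) S (GRing.isSubmodClosed.Build R M S h))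
  => x; split=> [/asboolP|?] //; apply/asboolP.
Qed.

Definition smod (U : submodClosed M) := {x : M | x \in U}.
HB.instance Definition _ (U : submodClosed M) := SubChoice.on (smod U).
HB.instance Definition _ (U : submodClosed M) :=
  [SubChoice_isSubLmodule of smod U by <:].

Definition sincl (U : submodClosed M) : {linear smod U -> M} := val.

Lemma submodN (U : submodClosed M) x : x \in U -> - x \in U.
Proof. by move=> Ux; rewrite -scaleN1r rpredZ. Qed.

Lemma submodB (U : submodClosed M) x y : x \in U -> y \in U -> x - y \in U.
Proof. by move=> Ux Uy; rewrite rpredD ?submodN. Qed.

Section Quotient.
Variable U : submodClosed M.
Local Open Scope quotient_scope.

Definition submod_zmod : zmodClosed M := HB.pack_for (zmodClosed M)
  (GRing.SubmodClosed.sort U)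
  (GRing.isZmodClosed.Build M (GRing.SubmodClosed.sort U)
    (GRing.submod_closedB (submodClosedP U))).

Definition qmod : Type := Quotient.quot submod_zmod.
HB.instance Definition _ := GRing.Zmodule.on qmod.
HB.instance Definition _ := ZmodQuotient.on qmod.

Definition qmod_scale (a : R) (x : qmod) : qmod := \pi_qmod (a *: repr x).

Lemma qmod_piP x y : \pi_qmod x = \pi_qmod y <-> x - y \in U.
Proof.
rewrite -[x - y \in U]/(x - y \in submod_zmod) Quotient.idealrBE.
by split=> [->|/eqP].
Qed.

Lemma qmodW (P : qmod -> Prop) : (forall x, P (\pi_qmod x)) -> forall y, P y.
Proof. by move=> h y; rewrite -[y]reprK. Qed.

Lemma qmod_scaleE a x : qmod_scale a (\pi_qmod x) = \pi_qmod (a *: x).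
Proof.
apply/qmod_piP; rewrite -scalerBr rpredZ //; apply/qmod_piP.
by rewrite reprK.
Qed.

Lemma qmod_piD x y : \pi_qmod (x + y) = \pi_qmod x + \pi_qmod y.
Proof. by rewrite raddfD. Qed.

Fact qmod_scaleA a b x : qmod_scale a (qmod_scale b x) = qmod_scale (a * b) x.
Proof. by elim/qmodW: x => x; rewrite !qmod_scaleE scalerA. Qed.
Fact qmod_scale1 : left_id 1 qmod_scale.
Proof. by elim/qmodW => x; rewrite qmod_scaleE scale1r. Qed.
Fact qmod_scaleDr : right_distributive qmod_scale +%R.
Proof.
move=> a; elim/qmodW=> x; elim/qmodW=> y.
by rewrite -qmod_piD !qmod_scaleE scalerDr qmod_piD.
Qed.
Fact qmod_scaleDl x : {morph qmod_scale^~ x : a b / a + b}.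
Proof.
by elim/qmodW: x => x a b; rewrite !qmod_scaleE scalerDl qmod_piD.
Qed.
HB.instance Definition _ := GRing.Zmodule_isLmodule.Build R qmod
  qmod_scaleA qmod_scale1 qmod_scaleDr qmod_scaleDl.

Fact qpi_linear : linear (\pi_qmod : M -> qmod).
Proof. by move=> a x y; rewrite qmod_piD -qmod_scaleE. Qed.

Definition qpi_fun (x : M) : qmod := \pi_qmod x.
HB.instance Definition _ := GRing.isLinear.Build R M qmod _ qpi_fun qpi_linear.
Definition qpi : {linear M -> qmod} := qpi_fun.

Lemma qpi_eq0 x : qpi x = 0 <-> x \in U.
Proof. by rewrite -[0](linear0 qpi) /= /qpi_fun qmod_piP subr0. Qed.

Lemma qpiZ a x : qpi (a *: x) = a *: qpi x.
Proof. exact: linearZ. Qed.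

Lemma qpi_surj y : exists x, qpi x = y.
Proof. by exists (repr y); rewrite /= /qpi_fun reprK. Qed.
End Quotient.
End Submodules.

Lemma linear_ex (R : pzRingType) (M N : lmodType R) (f : M -> N) :
  linear f -> exists g : {linear M -> N}, forall x, g x = f x.
Proof.
move=> h.
by exists (HB.pack_for {linear M -> N} f (GRing.isLinear.Build R M N _ f h)).
Qed.

Lemma linear_inj0 (R : pzRingType) (M N : lmodType R) (f : {linear M -> N}) :
  (forall x, f x = 0 -> x = 0) -> injective f.
Proof. by move=> h x y e; apply/subr0_eq/h; rewrite linearB e subrr. Qed.

(** * Noetherian rings *)

Section Noetherian.
Variable R : comPzRingType.

Definition generates (M : lmodType R) (U : submodClosed M) n (g : 'I_n -> M) :=
  (forall i, g i \in U) /\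
  forall x, x \in U -> exists c : 'I_n -> R, x = \sum_(i < n) c i *: g i.

Lemma ideal_ex (P : R -> Prop) :
    P 0 -> (forall u v, P u -> P v -> P (u + v)) ->
    (forall a u, P u -> P (a * u)) ->
  exists I : {pred R}, ideal I /\ forall x, x \in I <-> P x.
Proof.
move=> P0 PD PM; exists (fun x => `[< P x >]).
have E x : x \in (fun x => `[< P x >]) <-> P x.
  by split=> [/asboolP|?] //; apply/asboolP.
split=> //; split; first exact/E.
  by move=> u v /E Pu /E Pv; apply/E/PD.
by move=> a u /E Pu; apply/E/PM.
Qed.

Lemma spec_ex (P : R -> Prop) :
    P 0 -> (forall u v, P u -> P v -> P (u + v)) ->
    (forall a u, P u -> P (a * u)) -> ~ P 1 ->
    (forall u v, P (u * v) -> P u \/ P v) ->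
  exists p : spec R, forall x, x \in p <-> P x.
Proof.
move=> P0 PD PM P1 Pp; have [I [idI IE]] := ideal_ex P0 PD PM.
have pI : prime_ideal I.
  split=> // [|u v /IE /Pp[/IE|/IE]]; [|by left|by right].
  by apply/negP => /IE.
by exists (Spec pI).
Qed.

Section Spec.
Variable p : spec R.

Lemma spec0 : 0 \in p. Proof. by case: (specP p) => -[]. Qed.
Lemma specD u v : u \in p -> v \in p -> u + v \in p.
Proof. by case: (specP p) => -[_ h _] _ _; apply: h. Qed.
Lemma specMr a u : u \in p -> a * u \in p.
Proof. by case: (specP p) => -[_ _ h] _ _; apply: h. Qed.
Lemma specMl a u : u \in p -> u * a \in p.
Proof. by rewrite mulrC; apply: specMr. Qed.
Lemma spec1 : 1 \notin p. Proof. by case: (specP p). Qed.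
Lemma specM u v : u * v \in p -> u \in p \/ v \in p.
Proof. by case: (specP p) => _ _; apply. Qed.
Lemma specMN u v : u \notin p -> v \notin p -> u * v \notin p.
Proof. by move=> /negP u_p /negP v_p; apply/negP => /specM[]. Qed.
Lemma spec_prod n (s : 'I_n -> R) :
  (forall i, s i \notin p) -> \prod_(i < n) s i \notin p.
Proof.
move=> h; apply: (big_ind (fun x => x \notin p)) => [|u v|i _].
- exact: spec1.
- exact: specMN.
- exact: h.
Qed.
End Spec.

Lemma spec_ext (p q : spec R) : p =i q -> p = q.
Proof.
case: p q => [p pP] [q qP] /= e.
have {}e : p = q by apply: funext => x; apply: e.
by case: q / e qP => qP; congr Spec; apply: Prop_irrelevance.
Qed.

Definition fsplit (T : Type) k l (u : 'I_k -> T) (v : 'I_l -> T) (i : 'I_(k + l)) :=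
  match split i with inl j => u j | inr j => v j end.

Lemma sum_fsplit (M : lmodType R) k l (a : 'I_k -> R) (b : 'I_l -> R)
    (u : 'I_k -> M) (v : 'I_l -> M) :
  \sum_(i < k + l) fsplit a b i *: fsplit u v i =
  \sum_(i < k) a i *: u i + \sum_(i < l) b i *: v i.
Proof.
rewrite big_split_ord /=; congr (_ + _); apply: eq_bigr => i _.
  by rewrite /fsplit (unsplitK (inl i : 'I_k + 'I_l)).
by rewrite /fsplit (unsplitK (inr i : 'I_k + 'I_l)).
Qed.

Hypothesis noethR : noetherian R.

(** Induction on [n]: the possible coefficients of [g ord0] in elements of [U] form an ideal. Lifts
    of its generators, together with generators of the part of [U] in the span of the other [g i],
    generate [U]. *)
Lemma sub_span_fg (M : lmodType R) n (g : 'I_n -> M) (U : submodClosed M) :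
    (forall x, x \in U -> exists c : 'I_n -> R, x = \sum_(i < n) c i *: g i) ->
  exists k (h : 'I_k -> M), generates U h.
Proof.
elim: n g U => [|n IHn] g U gU.
  exists 0%N, g; split=> [[]//|x /gU]; exact.
pose g' i := g (lift ord0 i).
pose lc (c : 'I_n -> R) : M := \sum_(i < n) c i *: g' i.
have lcD a c d : a *: lc c + lc d = lc (fun i => a * c i + d i).
  rewrite /lc scaler_sumr -big_split /=; apply: eq_bigr => i _.
  by rewrite scalerDl scalerA.
have lc0 : lc (fun=> 0) = 0 by apply: big1 => i _; rewrite scale0r.
have [||a x [c xU]|I [idI IE]] := @ideal_ex
    (fun a => exists c, a *: g ord0 + lc c \in U).
- by exists (fun=> 0); rewrite lc0 addr0 scale0r rpred0.
- move=> a b [c cU] [d dU]; exists (fun i => 1 * c i + d i).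
  by rewrite -lcD scale1r scalerDl addrACA rpredD.
- exists (fun i => a * c i + 0); rewrite -(lcD _ _ (fun=> 0)) lc0 addr0.
  by rewrite -scalerA -scalerDr rpredZ.
have [k [a [aI aP]]] := noethR idI.
have /choice[c cP] : forall i, exists c, a i *: g ord0 + lc c \in U.
  by move=> i; apply/IE.
pose u i := a i *: g ord0 + lc (c i).
have [||V VE] := @submod_ex _ M (fun x => x \in U /\ exists c, x = lc c).
- by rewrite rpred0; split=> //; exists (fun=> 0).
- move=> b x y [xU [d xE]] [yU [e yE]]; split; first by rewrite rpredD ?rpredZ.
  by rewrite xE yE lcD; eexists.
have [l [h [hV hP]]] : exists k (h : 'I_k -> M), generates V h.
  by apply: (IHn g') => x /VE[_ [d ->]]; exists d.
exists (k + l)%N, (fsplit u h); split=> [i|x xU].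
  by rewrite /fsplit; case: split => j; [apply: cP | have /VE[] := hV j].
have [d] := gU _ xU; rewrite big_ord_recl -/(lc (fun i => d (lift ord0 i))).
set e := fun i => _ => xE.
have /aP[b bE] : d ord0 \in I by apply/IE; exists e; rewrite -xE.
have /hP[f fE] : x - \sum_(i < k) b i *: u i \in V.
  apply/VE; split.
    by rewrite submodB // rpred_sum // => i _; rewrite rpredZ ?cP.
  have -> : \sum_(i < k) b i *: u i =
      d ord0 *: g ord0 + lc (fun i => \sum_(j < k) b j * c j i).
    rewrite bE scaler_suml /lc.
    under [X in _ = _ + X]eq_bigr => i _ do rewrite scaler_suml.
    rewrite exchange_big -big_split /=; apply: eq_bigr => i _.
    rewrite /u scalerDr scalerA /lc scaler_sumr; congr (_ + _).
    by apply: eq_bigr => j _; rewrite scalerA.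
  rewrite xE opprD addrACA subrr add0r -scaleN1r addrC lcD.
  by eexists.
by exists (fsplit b f); rewrite sum_fsplit -fE addrC subrK.
Qed.

Lemma sub_fg (M : lmodType R) (U : submodClosed M) :
  fin_gen M -> exists k (h : 'I_k -> M), generates U h.
Proof. by case=> n [g gP]; apply: (sub_span_fg (g := g)) => x _. Qed.

Lemma inj_fg (M N : lmodType R) (f : {linear M -> N}) :
  injective f -> fin_gen N -> fin_gen M.
Proof.
move=> inj_f fgN.
have [||U UE] := @submod_ex _ N (fun y => exists x, f x = y).
- by exists 0; rewrite linear0.
- by move=> a _ _ [x <-] [y <-]; exists (a *: x + y); rewrite linearP.
have [k [h [hU hP]]] := sub_fg U fgN.
have /choice[g gE] : forall i, exists x, f x = h i by move=> i; apply/UE.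
exists k, g => x; have /hP[c xE] : f x \in U by apply/UE; exists x.
exists c; apply: inj_f; rewrite xE linear_sum; apply: eq_bigr => i _.
by rewrite linearZ gE.
Qed.

Lemma smod_fg (M : lmodType R) (U : submodClosed M) :
  fin_gen M -> fin_gen (smod U).
Proof. by apply: (inj_fg (f := sincl U)); apply: val_inj. Qed.

Lemma surj_fg (M N : lmodType R) (f : {linear M -> N}) :
  (forall y, exists x, f x = y) -> fin_gen M -> fin_gen N.
Proof.
move=> f_surj [n [g gP]]; exists n, (f \o g) => y.
have [x <-] := f_surj y; have [c ->] := gP x; exists c.
by rewrite linear_sum; apply: eq_bigr => i _; rewrite linearZ.
Qed.

(** Otherwise choice yields a strictly increasing chain; the finitely many generators of its union
    lie in one term, a contradiction. *)
Lemma max_submod (M : lmodType R) (P : submodClosed M -> Prop) :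
    fin_gen M -> (exists U, P U) ->
  exists U, P U /\ forall V, P V -> {subset U <= V} -> {subset V <= U}.
Proof.
move=> fgM [U0 PU0]; apply: contrapT => noMax.
have step (U : {U | P U}) : exists V : {V | P V},
    {subset sval U <= sval V} /\ ~ {subset sval V <= sval U}.
  apply: contrapT => h; apply: noMax; exists (sval U); split=> [|V PV UV].
    exact: svalP.
  by apply: contrapT => VU; apply: h; exists (exist _ V PV).
have [f fP] := choice step.
pose S n := iter n f (exist _ U0 PU0).
have Smon m n : (m <= n)%N -> {subset sval (S m) <= sval (S n)}.
  move=> /subnK <-; elim: (n - m)%N => // k IHk x /IHk.
  by rewrite addSn /S iterS; apply: (fP _).1.
have [||W WE] := @submod_ex _ M (fun x => exists n, x \in sval (S n)).
- by exists 0%N; rewrite rpred0.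
- move=> a x y [m xS] [n yS]; exists (maxn m n).
  by rewrite rpredD ?rpredZ //; [apply: Smon xS | apply: Smon yS];
    rewrite ?leq_maxl ?leq_maxr.
have [k [g [gW gP]]] := sub_fg W fgM.
have /choice[m mP] : forall i, exists n, g i \in sval (S n).
  by move=> i; apply/WE.
pose N := \max_(i < k) m i.
apply: (fP (S N)).2 => x xS.
have /gP[c ->] : x \in W by apply/WE; exists N.+1.
rewrite rpred_sum // => i _; rewrite rpredZ //.
by apply: Smon (mP i); apply: (leq_bigmax i).
Qed.
End Noetherian.

(** * Associated primes *)

Lemma lift_through_inj (R : pzRingType) (A B M : lmodType R) (i : {linear A -> B})
    (f : {linear M -> B}) :
    injective i -> (forall x, exists a, i a = f x) ->
  exists g : {linear M -> A}, forall x, i (g x) = f x.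
Proof.
move=> inj_i /choice[g gE]; have [|h hE] := @linear_ex _ _ _ g.
  by move=> a x y; apply: inj_i; rewrite linearP !gE linearP.
by exists h => x; rewrite hE.
Qed.

Lemma corestrict_ex (R : pzRingType) (M N : lmodType R) (f : {linear M -> N})
    (U : submodClosed N) :
  (forall x, f x \in U) ->
  exists g : {linear M -> smod U}, forall x, val (g x) = f x.
Proof.
move=> fU; apply: (lift_through_inj (i := sincl U)) => [|x]; first exact: val_inj.
by exists (Sub (f x) (fU x)).
Qed.

Lemma qmod_lift (R : pzRingType) (M N : lmodType R) (f : {linear M -> N})
    (U : submodClosed M) :
  (forall x, x \in U -> f x = 0) ->
  exists g : {linear qmod U -> N}, forall x, g (qpi U x) = f x.
Proof.
move=> fU; pose g (y : qmod U) := f (repr y).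
have gE x : g (qpi U x) = f x.
  apply/subr0_eq; rewrite -linearB; apply: fU.
  by apply/qpi_eq0; rewrite linearB /= /qpi_fun reprK subrr.
have [|h hE] := @linear_ex _ _ _ g; last by exists h => x; rewrite hE gE.
move=> a u v; have [x <-] := qpi_surj u; have [y <-] := qpi_surj v.
by rewrite -linearP !gE linearP.
Qed.

Section AssociatedPrimes.
Variables (R : comPzRingType) (noethR : noetherian R).

Lemma zero_submod (M : lmodType R) :
  exists U : submodClosed M, forall x, x \in U <-> x = 0.
Proof.
by apply: submod_ex => // a x y -> ->; rewrite scaler0 addr0.
Qed.

Lemma add_cyclic (M : lmodType R) (W : submodClosed M) (x : M) :
  exists U : submodClosed M, forall y, y \in U <-> exists r, y - r *: x \in W.
Proof.
apply: submod_ex; first by exists 0; rewrite scale0r subr0 rpred0.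
move=> a y z [r yW] [s zW]; exists (a * r + s).
rewrite scalerDl opprD addrACA -scalerA -scalerBr.
by rewrite rpredD ?rpredZ.
Qed.

Lemma Ass_qmod (M : lmodType R) (W : submodClosed M) q :
  Ass (qmod W) q <-> exists x, forall r, r \in q <-> r *: x \in W.
Proof.
split=> -[x xE].
  have [y yx] := qpi_surj x; exists y => r.
  by rewrite xE -yx -qpiZ qpi_eq0.
by exists (qpi W x) => r; rewrite xE -qpiZ qpi_eq0.
Qed.

Lemma regular_fg : fin_gen (R^o : lmodType R).
Proof.
by exists 1%N, (fun=> 1) => x; exists (fun=> x); rewrite big_ord1 /GRing.scale /= mulr1.
Qed.

(** Among the annihilators of multiples of [x] that avoid [S], a maximal one is prime. Later [S] is
    [{1}], the powers of an element, or the complement of a prime. *)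
Lemma Ass_ex (M : lmodType R) (S : R -> Prop) (x : M) :
    S 1 -> (forall a b, S a -> S b -> S (a * b)) ->
    (forall s, S s -> s *: x <> 0) ->
  exists r (q : spec R), (forall t, t \in q <-> t *: (r *: x) = 0) /\
                         forall s, S s -> s \notin q.
Proof.
move=> S1 SM Sx.
have [|I [[r [rI IS]] maxI]] := @max_submod _ noethR R^o (fun I =>
   exists r, (forall t : R, (t : R^o) \in I <-> t *: (r *: x) = 0) /\
   forall s : R, S s -> ~ (s : R^o) \in I) regular_fg.
  have [||I IE] := @submod_ex _ R^o (fun t : R => t *: x = 0).
  - by rewrite scale0r.
  - by move=> a u v ux vx; rewrite scalerDl vx addr0 -scalerA ux scaler0.
  exists I, 1; split=> [t|s Ss /IE]; last exact: Sx.
  by rewrite scale1r IE.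
(* By maximality, a further factor [u] either makes the annihilator meet [S] or leaves it
   unchanged. *)
have step (u : R) : ~ (forall s, S s -> s *: ((u * r) *: x) <> 0) \/
    forall v : R, v *: ((u * r) *: x) = 0 -> v *: (r *: x) = 0.
  have [h|] := pselect (forall s, S s -> s *: ((u * r) *: x) <> 0); last by left.
  right; have [||J JE] := @submod_ex _ R^o (fun t : R => t *: ((u * r) *: x) = 0).
  - by rewrite scale0r.
  - by move=> a b c bx cx; rewrite scalerDl cx addr0 -(scalerA a b) bx scaler0.
  move=> v /JE vJ; apply/rI; apply: maxI vJ.
    by exists (u * r); split=> // s Ss /JE; apply: h.
  move=> t /rI tI; apply/JE.
  by rewrite -[(u * r) *: x]scalerA scalerA mulrC -scalerA tI scaler0.
have [|||||q qE] := @spec_ex R (fun t => t *: (r *: x) = 0).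
- by rewrite scale0r.
- by move=> u v ux vx; rewrite scalerDl ux vx addr0.
- by move=> a u ux; rewrite -scalerA ux scaler0.
- by move/rI; apply: IS.
- move=> u v uv; apply: contrapT => /not_orP[ux vx].
  have [h|h] := step u; last first.
    by apply: vx; apply: h; rewrite -[(u * r) *: x]scalerA scalerA [v * u]mulrC.
  (* Here [s] in [S] kills [u r x]. Either the annihilator of [s r x] meets [S], and then so does
     that of [r x], or [u], which kills [s r x], already kills [r x]. *)
  apply: h => s Ss sx.
  have [h|h] := step s.
    apply: h => t St; rewrite -[(s * r) *: x]scalerA scalerA.
    by move/rI; apply: IS; apply: SM.
  apply: ux; apply: h.
  by rewrite -[(s * r) *: x]scalerA scalerA mulrC -scalerA [u *: _]scalerA.
exists r, q; split=> // s Ss; apply/negP => /qE /rI; exact: IS.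
Qed.

Lemma Ass_ex0 (M : lmodType R) (x : M) : x <> 0 ->
  exists r (q : spec R), forall t, t \in q <-> t *: (r *: x) = 0.
Proof.
move=> x0; have [||s ->|r [q [qE _]]] := @Ass_ex M (fun s => s = 1) x => //.
- by move=> a b -> ->; rewrite mulr1.
- by rewrite scale1r.
by exists r, q.
Qed.

(** Take [W] maximal. If [x] has annihilator [q] modulo [W], then [W + Rx] contains some [b] in [B]
    outside [L], congruent to [r x] with [r] outside [q]. As [q] is prime, it is also the
    annihilator of [b] modulo [W], hence modulo [L]. *)
Lemma complement (M : lmodType R) (L A B : submodClosed M) :
    fin_gen M -> {subset L <= A} ->
    (forall x, x \in A -> x \in B -> x \in L) ->
  exists W : submodClosed M,
    [/\ {subset A <= W}, forall x, x \in W -> x \in B -> x \in L,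
        forall U : submodClosed M, {subset W <= U} ->
          (forall x, x \in U -> x \in B -> x \in L) -> {subset U <= W}
      & forall (q : spec R) x, (forall r, r \in q <-> r *: x \in W) ->
          exists b, b \in B /\ forall r, r \in q <-> r *: b \in L].
Proof.
move=> fgM LA AB.
have [|W [[AW WB] maxW]] := max_submod noethR (M := M) (P := fun W =>
    {subset A <= W} /\ forall x, x \in W -> x \in B -> x \in L) fgM.
  by exists A; split.
exists W; split=> // [U WU UB|q x qE]; first by apply: maxW => //; split=> // y /AW /WU.
have [U UE] := add_cyclic W x.
have WU : {subset W <= U} by move=> y yW; apply/UE; exists 0; rewrite scale0r subr0.
have [b [bU bB bL]] : exists b, [/\ b \in U, b \in B & ~ b \in L].
  apply: contrapT => h; have /qE : 1 *: x \in W.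
    rewrite scale1r; apply: (maxW U) => //; first split.
    - by move=> y /AW /WU.
    - by move=> y yU yB; apply: contrapT => yL; apply: h; exists y.
    by apply/UE; exists 1; rewrite scale1r subrr rpred0.
  by apply/negP/spec1.
have /UE[r brW] := bU.
have rq : r \notin q.
  apply/negP => /qE rxW; apply: bL; apply: WB bB.
  by rewrite -[b](subrK (r *: x)) rpredD.
have EW t : (t *: b \in W) <-> t * r \in q.
  rewrite qE -scalerA; split=> tW.
    by rewrite -[t *: _](subKr (t *: b)) -scalerBr submodB // rpredZ.
  by rewrite -[t *: b](subrK (t *: (r *: x))) -scalerBr rpredD // rpredZ.
exists b; split=> // t; split=> [tq|/LA/AW/EW/specM[]//]; last by rewrite (negPf rq).
apply: WB; last exact: rpredZ.
by apply/EW/specMl.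
Qed.

Lemma common_denom (p : spec R) (M : lmodType R) (U N : submodClosed M) :
    fin_gen M -> (forall x, x \in U -> exists2 s, s \notin p & s *: x \in N) ->
  exists2 s, s \notin p & forall x, x \in U -> s *: x \in N.
Proof.
move=> fgM UN; have [k [h [hU hP]]] := sub_fg noethR U fgM.
have /choice[t tP] : forall i, exists t, t \notin p /\ t *: h i \in N.
  by move=> i; have [t] := UN _ (hU i); exists t.
exists (\prod_(i < k) t i); first by apply: spec_prod => i; case: (tP i).
move=> x /hP[c ->]; rewrite scaler_sumr rpred_sum // => i _.
rewrite scalerA mulrC -scalerA rpredZ // (bigD1 i) //= mulrC -scalerA.
by rewrite rpredZ //; case: (tP i).
Qed.

(** * Modules with at most one associated prime *)

Section Coprimary.
Variables (M : lmodType R) (p : spec R).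
Hypothesis AssM : forall q, Ass M q -> q = p.

Lemma coprimary_regular s (x : M) : s \notin p -> s *: x = 0 -> x = 0.
Proof.
move=> sp sx; apply: contrapT => /Ass_ex0 [r [q qE]].
have qp : q = p by apply: AssM; exists (r *: x).
move/negP: sp; apply; rewrite -qp; apply/qE.
by rewrite scalerA mulrC -scalerA sx scaler0.
Qed.

(** Otherwise [Ass_ex] for the powers of [s] gives an associated prime avoiding [s]. *)
Lemma coprimary_nilpotent s (x : M) : s \in p -> exists k, s ^+ k *: x = 0.
Proof.
move=> sp; apply: contrapT => h.
have [|||r [q [qE qS]]] := @Ass_ex M (fun t => exists k, t = s ^+ k) x.
- by exists 0%N.
- by move=> _ _ [k ->] [l ->]; exists (k + l)%N; rewrite exprD.
- by move=> _ [k ->] sx; apply: h; exists k.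
have qp : q = p by apply: AssM; exists (r *: x).
have /negP := qS s (ex_intro _ 1%N (esym (expr1 s))); apply.
by rewrite qp.
Qed.
End Coprimary.

(** * Dévissage along associated primes *)

Section Devissage.
Variable T : mod_class R.
Hypothesis T0 : forall Z : lmodType R, (forall z : Z, z = 0) -> T Z.
Hypothesis Tsub : forall (M N : lmodType R) (f : {linear M -> N}),
  injective f -> T N -> T M.

(** Let [N] be a maximal submodule with [T]. If [N] is not [M], a prime associated to [M/N] equals
    [p]: one inclusion holds because [N] is saturated outside [p], the other by nilpotency.
    Enlarging [N] by a copy of [R/p] contradicts maximality. *)
Lemma coprimary_devissage (p : spec R) (M : lmodType R) :
    (forall (N : lmodType R) (D : submodClosed N) (m : N), fin_gen N ->
       T (smod D) -> (forall s (x : N), s \notin p -> s *: x = 0 -> x = 0) ->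
       (forall y, exists r, y - r *: m \in D) ->
       (forall r, r \in p <-> r *: m \in D) -> T N) ->
  fin_gen M -> (forall q, Ass M q -> q = p) -> T M.
Proof.
move=> Text fgM AssM.
have [|N [TN maxN]] := max_submod noethR (P := fun N => T (smod N)) fgM.
  have [Z ZE] := zero_submod M; exists Z; apply: T0 => z; apply: val_inj.
  exact/ZE/valP.
suff NM x : x \in N.
  have [g gE] := @corestrict_ex _ M M (idfun : {linear M -> M}) N NM.
  by apply: (Tsub (f := g)) TN => y z e; rewrite -[y]gE e gE.
(* A common denominator [t0] embeds the saturation of [N] into [N], so the saturation has [T] and
   equals [N]. *)
have Nsat s y : s \notin p -> s *: y \in N -> y \in N.
  move=> sp syN.
  have [||S SE] := @submod_ex _ M (fun y => exists2 s, s \notin p & s *: y \in N).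
  - by exists 1; rewrite ?scaler0 ?rpred0 ?spec1.
  - move=> a u v [t tp tu] [t' t'p tv]; exists (t * t'); first exact: specMN.
    rewrite scalerDr rpredD //; last by rewrite -scalerA rpredZ.
    have -> : (t * t') *: (a *: u) = (a * t') *: (t *: u).
      by rewrite !scalerA; congr (_ *: _); ring.
    exact: rpredZ.
  have [|t0 t0p t0S] := @common_denom p M S N fgM; first by move=> u /SE.
  have [|f fE] := @linear_ex _ (smod S) M (fun u => t0 *: val u).
    by move=> a u v; rewrite /= scalerDr !scalerA mulrC.
  have [|g gE] := @corestrict_ex _ _ _ f N.
    by move=> u; rewrite fE; apply/t0S/valP.
  apply: (maxN S); last by apply/SE; exists s.
    apply: (Tsub (f := g)) TN => u v e; apply: val_inj.
    apply/subr0_eq/(coprimary_regular AssM t0p).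
    by rewrite scalerBr -!fE -!gE e subrr.
  by move=> u uN; apply/SE; exists 1; rewrite ?spec1 // scale1r.
apply: contrapT => xN.
have [|r [q qE]] := @Ass_ex0 (qmod N) (qpi N x); first by move/qpi_eq0.
set y := r *: x.
have {}qE t : t \in q <-> t *: y \in N.
  by rewrite qE -(qpiZ N r x) -(qpiZ N t) qpi_eq0.
have yN : ~ y \in N by rewrite -[y]scale1r => /qE; apply/negP/spec1.
have qp t : t \in q <-> t \in p.
  split=> [/qE tyN|tp].
    by apply: contrapT => /negP tp; apply: yN; apply: Nsat tyN.
  have [k tk] := coprimary_nilpotent AssM y tp.
  have : t ^+ k \in q by apply/qE; rewrite tk rpred0.
  elim: k {tk} => [|k IHk]; first by rewrite expr0 (negPf (spec1 q)).
  by rewrite exprS => /specM[].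
have [N' N'E] := add_cyclic N y.
have NN' : {subset N <= N'}.
  by move=> u uN; apply/N'E; exists 0; rewrite scale0r subr0.
have yN' : y \in N' by apply/N'E; exists 1; rewrite scale1r subrr rpred0.
apply: yN; apply: (maxN N') => //.
have [||D DE] := @submod_ex _ (smod N') (fun u => val u \in N).
- exact: rpred0.
- by move=> a u v uN vN; rewrite /= rpredD ?rpredZ.
apply: (Text _ D (Sub y yN')).
- exact: smod_fg.
- have [|g gE] := @corestrict_ex _ (smod D) M
      (sincl N' \o sincl D : {linear _ -> _}) N.
    by move=> u; apply/DE/(valP u).
  apply: (Tsub (f := g)) TN => u v e; do 2!apply: val_inj.
  by have := gE u; rewrite e gE.
- move=> s u sp su; apply: val_inj; apply: (coprimary_regular AssM sp).
  by rewrite -[_ *: _]/(val (s *: u)) su.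
- by move=> u; have /N'E[t] := valP u; exists t; apply/DE.
- by move=> t; rewrite -qp qE DE.
Qed.

Hypothesis Tprod : forall M N : lmodType R, T M -> T N -> T (M * N)%type.

(** Take [L] maximal such that [M/L] is a counterexample; it has two distinct associated primes.
    They give submodules [W1] and [W2] strictly larger than [L], without new associated primes in
    their quotients, that meet inside [L]. So [M/L] embeds into a product of two quotients which
    have [T] by maximality. *)
Lemma devissage (Phi : spec R -> Prop) (M : lmodType R) :
    (forall p N, Phi p -> fin_gen N -> (forall q, Ass N q -> q = p) -> T N) ->
  fin_gen M -> (forall p, Ass M p -> Phi p) -> T M.
Proof.
move=> Tcop fgM AssM; apply: contrapT => notTM.
pose P (L : submodClosed M) := (forall q, Ass (qmod L) q -> Phi q) /\ ~ T (qmod L).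
have [|L [[AssL notTL] maxL]] := max_submod noethR (P := P) fgM.
  have [Z ZE] := zero_submod M; exists Z; split=> [q /Ass_qmod[x qE]|TZ].
    by apply: AssM; exists x => r; rewrite qE ZE.
  by apply: notTM; apply: Tsub TZ; apply: linear_inj0 => x /qpi_eq0 /ZE.
have fgL : fin_gen (qmod L) := surj_fg (qpi_surj (U := L)) fgM.
have [p pL] : exists p, Ass (qmod L) p.
  apply: contrapT => h; apply: notTL; apply: T0 => z; apply: contrapT => /Ass_ex0.
  by case=> r [q qE]; apply: h; exists q, (r *: z).
have [q qL qp] : exists2 q, Ass (qmod L) q & q <> p.
  apply: contrapT => h; apply: notTL; apply: (Tcop p) => //; first exact: AssL.
  by move=> q qL; apply: contrapT => qp; apply: h; exists q.
have /Ass_qmod[x xE] := pL; have /Ass_qmod[y yE] := qL.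
have [A AE] := add_cyclic L x; have [B BE] := add_cyclic L y.
have LA : {subset L <= A} by move=> u uL; apply/AE; exists 0; rewrite scale0r subr0.
have LB : {subset L <= B} by move=> u uL; apply/BE; exists 0; rewrite scale0r subr0.
have xA : x \in A by apply/AE; exists 1; rewrite scale1r subrr rpred0.
have yB : y \in B by apply/BE; exists 1; rewrite scale1r subrr rpred0.
(* As [R/s] is a domain, every element of [L + Rw] outside [L] has annihilator [s] modulo [L]. *)
have colon (s : spec R) w z r : (forall r, r \in s <-> r *: w \in L) ->
    z - r *: w \in L -> ~ z \in L -> forall t, t \in s <-> t *: z \in L.
  move=> sE zrw zL t.
  have rs : r \notin s.
    by apply/negP => /sE rw; apply: zL; rewrite -[z](subrK (r *: w)) rpredD.
  transitivity (t * r \in s).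
    by split=> [/specMl //|/specM[]//]; rewrite (negPf rs).
  rewrite sE -scalerA; split=> tL.
    by rewrite -[t *: z](subrK (t *: (r *: w))) -scalerBr rpredD // rpredZ.
  by rewrite -[t *: _](subKr (t *: z)) -scalerBr submodB // rpredZ.
have AB z : z \in A -> z \in B -> z \in L.
  move=> /AE[r zr] /BE[s zs]; apply: contrapT => zL; apply: qp.
  apply: spec_ext => t.
  apply/idP/idP => tz.
    by apply/(colon _ _ _ _ xE zr zL)/(colon _ _ _ _ yE zs zL).
  by apply/(colon _ _ _ _ yE zs zL)/(colon _ _ _ _ xE zr zL).
have [W1 [AW1 W1B _ AssW1]] := complement fgM LA AB.
(* [W2] is taken against all of [W1] and not only [A], which forces the intersection into [L]. *)
have [|W2 [BW2 W2W1 _ AssW2]] := @complement M L B W1 fgM LB.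
  by move=> z zB zW1; apply: W1B.
have xL : ~ x \in L by rewrite -[x]scale1r => /xE; apply/negP/spec1.
have yL : ~ y \in L by rewrite -[y]scale1r => /yE; apply/negP/spec1.
have TW (W B' : submodClosed M) z : {subset L <= W} -> z \in W -> ~ z \in L ->
    (forall (q : spec R) x, (forall r, r \in q <-> r *: x \in W) ->
          exists b, b \in B' /\ forall r, r \in q <-> r *: b \in L) ->
    T (qmod W).
  move=> LW zW zL AssW; apply: contrapT => TW; apply/zL/(maxL W) => //; split=> //.
  move=> s /Ass_qmod[u sE]; have [b [_ bE]] := AssW _ _ sE.
  by apply/AssL/Ass_qmod; exists b.
have T1 : T (qmod W1).
  by apply: (TW W1 B x) => //; [move=> u /LA/AW1 | apply: AW1].
have T2 : T (qmod W2).
  by apply: (TW W2 W1 y) => //; [move=> u /LB/BW2 | apply: BW2].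
have [|f fE] := @linear_ex _ M (qmod W1 * qmod W2)%type (fun u => (qpi W1 u, qpi W2 u)).
  by move=> a u v; rewrite !linearP.
have [|g gE] := @qmod_lift _ _ _ f L.
  move=> u uL; rewrite fE; have /qpi_eq0 -> : u \in W1 by apply/AW1/LA.
  by have /qpi_eq0 -> : u \in W2 by apply/BW2/LB.
apply: notTL; apply: (Tsub (f := g)) (Tprod T1 T2).
apply: linear_inj0 => u; have [v <-] := qpi_surj u.
rewrite gE fE => -[/qpi_eq0 v1 /qpi_eq0 v2]; apply/qpi_eq0; exact: W2W1.
Qed.
End Devissage.
End AssociatedPrimes.

(** * KE-closed subcategories *)

Section KEClosed.
Variables (R : comPzRingType) (noethR : noetherian R).
Variables (X : mod_class R) (KE_X : KE_closed X).

Let X_fg M : X M -> fin_gen M. Proof. by case: KE_X => -[h _] _ _ _; apply: h. Qed.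
Let X_zero (Z : lmodType R) : (forall z : Z, z = 0) -> X Z.
Proof. by case: KE_X => _ [h _] _ _; apply: h. Qed.
Let X_prod (M N : lmodType R) : X M -> X N -> X (M * N)%type.
Proof. by case: KE_X => _ [_ h] _ _; apply: h. Qed.
Let X_ext : extension_closed X. Proof. by case: KE_X. Qed.
Let X_kernel : kernel_closed X. Proof. by case: KE_X. Qed.

Lemma X_ffun M n : X M -> X {ffun 'I_n -> M}.
Proof.
move=> XM; elim: n => [|n IHn].
  by apply: X_zero => z; apply/ffunP => -[].
have [|f fE] := @linear_ex _ {ffun 'I_n -> M} {ffun 'I_n.+1 -> M}
    (fun h => [ffun i => if unlift ord0 i is Some j then h j else 0]).
  move=> a u v; apply/ffunP => i; rewrite !ffunE.
  by case: unlift => [j|]; rewrite ?ffunE ?scaler0 ?addr0.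
have [|g gE] := @linear_ex _ {ffun 'I_n.+1 -> M} M (fun h => h ord0).
  by move=> a u v; rewrite !ffunE.
apply: (X_ext (f := f) (g := g)) => //.
- apply: linear_inj0 => h; rewrite fE => /ffunP hE; apply/ffunP => j.
  by have := hE (lift ord0 j); rewrite !ffunE liftK.
- by move=> c; exists [ffun=> c]; rewrite gE ffunE.
move=> h; rewrite gE; split=> [h0|[u <-]]; last by rewrite fE ffunE unlift_none.
exists [ffun j => h (lift ord0 j)]; rewrite fE; apply/ffunP => i; rewrite ffunE.
by case: unliftP => [j ->|->]; rewrite ?ffunE.
Qed.

(** * Target modules *)

Definition target (C : lmodType R) : Prop :=
  forall (N K : lmodType R) (f : {linear N -> C}) (i : {linear K -> N}),
    injective i -> (forall a, f a = 0 <-> exists k, i k = a) -> X N -> X K.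

Lemma target_X C : X C -> target C.
Proof. by move=> XC N K f i inj_i fi XN; apply: X_kernel inj_i fi XN XC. Qed.

Lemma target_ker (A C : lmodType R) (f : {linear A -> C}) (U : submodClosed A) :
  (forall x, x \in U <-> f x = 0) -> X A -> target C -> X (smod U).
Proof.
move=> UE XA YC; apply: (YC _ _ f (sincl U)) XA => [|x]; first exact: val_inj.
rewrite -UE; split=> [xU|[k <-]]; last exact: valP.
by exists (Sub x xU).
Qed.

Lemma target_sub (A B : lmodType R) (j : {linear A -> B}) :
  injective j -> target B -> target A.
Proof.
move=> inj_j YB N K f i inj_i fi; apply: (YB _ _ (j \o f : {linear _ -> _}) i) => // a.
by rewrite -(fi a) /= -{1}(linear0 j); split=> [/inj_j|->].
Qed.

Lemma target_zero (Z : lmodType R) : (forall z : Z, z = 0) -> target Z.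
Proof. by move=> /X_zero /target_X. Qed.

(** For [f : N -> B], the kernel [U] of [g \o f] lies in [X] because [C] is a target. On [U] the map
    [f] factors through [A], and this factor has the same kernel as [f]. *)
Lemma target_ext (A B C : lmodType R) (j : {linear A -> B}) (g : {linear B -> C}) :
    injective j -> (forall b, g b = 0 <-> exists a, j a = b) ->
  target A -> target C -> target B.
Proof.
move=> inj_j jg YA YC N K f i inj_i fi XN.
have [||U UE] := @submod_ex _ N (fun x => g (f x) = 0).
- by rewrite !linear0.
- by move=> a x y x0 y0; rewrite !linearP x0 y0 scaler0 addr0.
have XU : X (smod U) by apply: (target_ker (f := g \o f : {linear _ -> _})) UE XN YC.
have [|h hE] := @lift_through_inj _ _ _ _ j (f \o sincl U : {linear _ -> _}) inj_j.
  by move=> u; apply/jg/UE/valP.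
have [|k kE] := @corestrict_ex _ _ _ i U.
  move=> x; apply/UE; have -> : f (i x) = 0 by apply/fi; exists x.
  exact: linear0.
apply: (YA _ _ h k) XU => [x y e|u]; first by apply: inj_i; rewrite -!kE e.
transitivity (f (val u) = 0).
  by rewrite -[f _]/((f \o sincl U) u) -hE -(linear0 j); split=> [->|/inj_j].
rewrite fi; split=> -[x xE]; exists x; last by rewrite -kE xE.
by apply: val_inj; rewrite kE.
Qed.

Lemma target_prod (A B : lmodType R) : target A -> target B -> target (A * B)%type.
Proof.
have [|j jE] := @linear_ex _ A (A * B)%type (fun x => (x, 0)).
  by move=> a x y; rewrite /= -[RHS]/(_, _) /= scaler0 addr0.
apply: (target_ext (j := j) (g := (snd : {linear (A * B)%type -> B}))).
- by move=> x y; rewrite !jE => -[].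
- move=> [x y] /=; split=> [->|[z]]; first by exists x; rewrite jE.
  by rewrite jE => -[].
Qed.

(* [ker (N -> C)] is also the kernel of the projection to [B] of the fibre
   product of [N] and [B] over [C], an extension of [N] by [A]. *)
Lemma target_coker (A B C : lmodType R) (j : {linear A -> B}) (q : {linear B -> C}) :
    injective j -> (forall c, exists b, q b = c) ->
    (forall b, q b = 0 <-> exists a, j a = b) ->
  X A -> X B -> target C.
Proof.
move=> inj_j q_surj jq XA XB N K f i inj_i fi XN.
have [||P PE] := @submod_ex _ (N * B)%type (fun u => f u.1 = q u.2).
- by rewrite !linear0.
- by move=> a x y xE yE; rewrite !linearP /= xE yE.
have [|f1 f1E] := @linear_ex _ A (N * B)%type (fun x => (0, j x)).
  by move=> a x y; rewrite linearP -[RHS]/(_, _) /= scaler0 addr0.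
have [|g1 g1E] := @corestrict_ex _ _ _ f1 P.
  move=> x; apply/PE; rewrite f1E /= linear0; apply/esym/jq; by exists x.
have [|f2 f2E] := @linear_ex _ K (N * B)%type (fun x => (i x, 0)).
  by move=> a x y; rewrite linearP -[RHS]/(_, _) /= scaler0 addr0.
have [|g2 g2E] := @corestrict_ex _ _ _ f2 P.
  move=> x; apply/PE; rewrite f2E /= linear0; apply/fi; by exists x.
have XP : X (smod P).
  apply: (X_ext (f := g1) (g := (fst \o sincl P : {linear smod P -> N}))) => //.
  - by move=> x y /(congr1 val); rewrite !g1E !f1E => -[/inj_j].
  - move=> n; have [b bE] := q_surj (f n).
    have nbP : (n, b) \in P by apply/PE; rewrite /= bE.
    by exists (Sub (n, b) nbP).
  move=> u; split=> [/= u0|[x <-]]; last by rewrite /= g1E f1E.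
  have /PE := valP u; rewrite u0 linear0 => /esym/jq[a aE].
  exists a; apply: val_inj; rewrite g1E f1E aE.
  by rewrite [RHS]surjective_pairing; congr pair; apply/esym.
apply: (X_kernel (f := (snd \o sincl P : {linear smod P -> B})) (i := g2)) => //.
  by move=> x y /(congr1 val); rewrite !g2E !f2E => -[/inj_i].
move=> u; split=> [/= u0|[x <-]]; last by rewrite /= g2E f2E.
have /PE := valP u; rewrite u0 linear0 => /fi[a aE].
exists a; apply: val_inj; rewrite g2E f2E aE.
by rewrite [RHS]surjective_pairing; congr pair; apply/esym.
Qed.

Definition target_prime (p : spec R) := exists2 C, target C & Ass C p.

Lemma target_prime_X M p : X M -> Ass M p -> target_prime p.
Proof. by move=> /target_X; exists M. Qed.

(** Both [N/D] and [Rz] are copies of [R/p]: the coefficient of [m] in [y] modulo [D] is unique up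
    to [p], which kills [z]. *)
Lemma cyclic_quotient_map (p : spec R) (N Z : lmodType R) (D : submodClosed N)
    (m : N) (z : Z) :
    (forall y, exists r, y - r *: m \in D) ->
    (forall r, r \in p <-> r *: m \in D) ->
    (forall r, r \in p <-> r *: z = 0) ->
  exists g : {linear N -> Z}, (forall y, g y = 0 <-> y \in D) /\
    forall y r, y - r *: m \in D -> g y = r *: z.
Proof.
move=> /choice[g gP] mE zE.
have gE y r : y - r *: m \in D -> g y *: z = r *: z.
  move=> yr; apply/subr0_eq; rewrite -scalerBl; apply/zE/mE.
  have -> : (g y - r) *: m = (y - r *: m) - (y - g y *: m).
    by rewrite scalerBl opprB [RHS]addrC addrA subrK.
  by rewrite submodB.
have [|h hE] := @linear_ex _ _ _ (fun y => g y *: z).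
  move=> a x y; rewrite scalerA -scalerDl; apply: gE.
  by rewrite scalerDl opprD addrACA -scalerA -scalerBr rpredD // rpredZ.
exists h; split=> [y|y r yr]; last by rewrite hE; apply: gE.
rewrite hE -zE mE; split=> yD; last by rewrite -[_ *: m](subKr y) submodB.
by rewrite -[y](subrK (g y *: m)) rpredD.
Qed.

(** In each step of the dévissage the quotient [R/p] embeds into a target with associated prime [p],
    so closure under extensions applies. *)
Lemma target_Ass (M : lmodType R) :
  fin_gen M -> (forall p, Ass M p -> target_prime p) -> target M.
Proof.
move=> fgM AssM; apply: (@devissage _ noethR target) AssM => //.
- exact: target_zero.
- exact: target_sub.
- exact: target_prod.
move=> p N [Z YZ [z zE]] fgN; apply: (@coprimary_devissage _ noethR target) => //.
- exact: target_zero.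
- exact: target_sub.
move=> {fgN}N D m _ YD _ Nm pD.
have [g [gE _]] := cyclic_quotient_map Nm pD zE.
apply: (target_ext (j := sincl D) (g := g)) => // [|y]; first exact: val_inj.
by rewrite gE; split=> [yD|[u <-]]; [exists (Sub y yD) | apply: valP].
Qed.

Lemma X_sub (N : lmodType R) (U : submodClosed N) :
  X N -> (forall p, Ass (qmod U) p -> target_prime p) -> X (smod U).
Proof.
move=> XN AssU.
have YU : target (qmod U).
  by apply: target_Ass => //; apply: (surj_fg (qpi_surj (U := U))); apply: X_fg.
by apply: (target_ker (f := qpi U)) XN YU => x; rewrite qpi_eq0.
Qed.

(** This is Hom(R/p, N), the kernel of [x |-> (a i x)] from [N] to a power of [N], for generators
    [a i] of [p]. *)
Lemma X_annihilated (N : lmodType R) (p : spec R) :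
  X N -> exists2 U : submodClosed N, X (smod U) &
    forall x, x \in U <-> forall a, a \in p -> a *: x = 0.
Proof.
move=> XN; have [idp _ _] := specP p; have [n [a [ap aP]]] := noethR idp.
have [|f fE] := @linear_ex _ N {ffun 'I_n -> N} (fun x => [ffun i => a i *: x]).
  move=> b x y; apply/ffunP => i; rewrite !ffunE scalerDr !scalerA.
  by rewrite mulrC.
have [||U UE] := @submod_ex _ N (fun x => f x = 0).
- by rewrite linear0.
- by move=> b x y x0 y0; rewrite linearP x0 y0 scaler0 addr0.
exists U; first exact: target_ker UE XN (target_X (X_ffun n XN)).
move=> x; rewrite UE; split=> [/ffunP x0 b /aP[c ->]|x0].
  rewrite scaler_suml big1 // => i _; rewrite -scalerA.
  by have := x0 i; rewrite fE !ffunE => ->; rewrite scaler0.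
by rewrite fE; apply/ffunP => i; rewrite !ffunE x0 ?ap.
Qed.

(** [W] is torsion-free of rank one over [R/p]. In the part [N1] of [Z] killed by [p], take [V]
    maximal with zero intersection with [Rz], then [W] maximal containing [Rz] with zero
    intersection with [V]. The primes associated to [N1/W] come from [V], so [W] lies in [X]. *)
Lemma rank_one_ex (Z : lmodType R) (p : spec R) : X Z -> Ass Z p ->
  exists (W : lmodType R) (w : W), [/\ X W, forall r, r \in p <-> r *: w = 0,
    forall t (x : W), t \notin p -> t *: x = 0 -> x = 0
    & exists2 s, s \notin p & forall x, exists r, s *: x = r *: w].
Proof.
move=> XZ [z0 zE]; have [U XU UE] := X_annihilated p XZ.
have z0U : z0 \in U by apply/UE => a /zE.
have {z0 zE z0U UE} [N1 [XN1 [z zE] pN1]] : exists N1 : lmodType R,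
    [/\ X N1, exists z : N1, forall r, r \in p <-> r *: z = 0
       & forall a (x : N1), a \in p -> a *: x = 0].
  exists (smod U); split=> // [|a x ap]; last first.
    by apply: val_inj; have /UE := valP x; apply.
  exists (Sub z0 z0U) => r; rewrite zE; split=> [rz|/(congr1 val)//].
  exact: val_inj.
have fgN := X_fg XN1; have [O OE] := zero_submod N1.
have [A AE] := add_cyclic O z.
have {}AE y : y \in A <-> exists r, y = r *: z.
  rewrite AE; split=> -[r]; first by move/OE/subr0_eq; exists r.
  by move=> ->; exists r; rewrite subrr rpred0.
have OU (W : submodClosed N1) : {subset O <= W} by move=> x /OE ->; rewrite rpred0.
have [V [_ VA maxV _]] := complement noethR (B := A) fgN (OU O) (fun _ xO _ => xO).
have [|W [AW WV _ AssW]] := complement noethR (A := A) (B := V) fgN (OU A).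
  by move=> x xA xV; apply: VA.
have zW : z \in W by apply/AW/AE; exists 1; rewrite scale1r.
(* [Rz] is essential in [W]: by maximality [V + Ru] meets [Rz] nontrivially, and the [V]-component
   of a common element lies in [W], hence vanishes. *)
have ess u : u \in W -> u <> 0 -> exists r r', r *: u = r' *: z /\ r *: u <> 0.
  move=> uW u0; apply: contrapT => h; apply/u0/OE/WV => //.
  have [B BE] := add_cyclic V u.
  apply: (maxV B).
  - by move=> v vV; apply/BE; exists 0; rewrite scale0r subr0.
  - move=> y /BE[r yrV] yA.
    have /WV/(_ yrV)/OE/subr0_eq yru : y - r *: u \in W.
      by rewrite submodB ?rpredZ // AW.
    have /AE[r' yE] := yA.
    apply/OE; apply: contrapT => y0; apply: h; exists r, r'.
    by rewrite -yru -yE.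
  by apply/BE; exists 1; rewrite scale1r subrr rpred0.
(* Since [p] kills [N1], a nonzero multiple [r u] forces [r] outside [p]. *)
have [|s sp sW] := @common_denom _ noethR p N1 W A fgN.
  move=> u uW; have [->|/eqP u0] := eqVneq u 0.
    by exists 1; rewrite ?spec1 // scaler0 rpred0.
  have [r [r' [rE ru]]] := ess _ uW u0.
  exists r; first by apply/negP => rp; apply/ru/pN1.
  by apply/AE; exists r'.
exists (smod W), (Sub z zW); split.
- apply: X_sub => // q /Ass_qmod[x /AssW[b [bV bE]]].
  by apply: (target_prime_X XN1); exists b => r; rewrite bE OE.
- by move=> r; rewrite zE; split=> [rz|/(congr1 val)//]; apply: val_inj.
- move=> t x tp tx; apply: val_inj; apply: contrapT => x0.
  have [r [r' [rE rx]]] := ess _ (valP x) x0.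
  apply: rx; rewrite rE; apply/zE.
  have : t * r' \in p.
    apply/zE; rewrite -scalerA -rE scalerA mulrC -scalerA.
    by have := congr1 val tx => /= ->; rewrite scaler0.
  by move/specM => [] //; rewrite (negPf tp).
exists s => // x; have /sW/AE[r rE] := valP x.
by exists r; apply: val_inj.
Qed.

(** * Embedding into objects of the class *)

Section EmbedStep.
Variables (p : spec R) (W : lmodType R) (w : W) (s : R).
Hypotheses (XW : X W) (wE : forall r, r \in p <-> r *: w = 0).
Hypothesis regW : forall t (x : W), t \notin p -> t *: x = 0 -> x = 0.
Hypotheses (sp : s \notin p) (sW : forall x, exists r, s *: x = r *: w).

(** Regularity outside [p] is carried along the induction because the next embedding involves
    multiplication by [s]. *)
Definition embeds_regular (C : lmodType R) := exists (N : lmodType R),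
  [/\ X N, forall t (x : N), t \notin p -> t *: x = 0 -> x = 0
    & exists i : {linear C -> N}, injective i].

(* With [P] the pushout of [N] along [smod D -> N'] and [gP : P -> W] the map of
   kernel [N'], the module [E = {(y, x) | gP y = s x}] is an extension of [W]
   by [N'] that contains [N] through [y |-> (s y, gP y)]. *)
Lemma embeds_step (N : lmodType R) (D : submodClosed N) (m : N) :
    embeds_regular (smod D) -> (forall y, exists r, y - r *: m \in D) ->
    (forall r, r \in p <-> r *: m \in D) ->
  embeds_regular N.
Proof.
move=> [N' [XN' regN' [i inj_i]]] Nm pD.
have [g [gE gm]] := cyclic_quotient_map Nm pD wE.
have [||Q QE] := @submod_ex _ (N' * N)%type
    (fun u => exists d : smod D, u = (i d, - val d)).
- by exists 0; rewrite linear0 oppr0.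
- move=> a _ _ [d ->] [e ->]; exists (a *: d + e).
  by rewrite linearP /= opprD -scalerN.
pose P := qmod Q.
have [|j0 j0E] := @linear_ex _ N' (N' * N)%type (fun x => (x, 0)).
  by move=> a x y; rewrite -[RHS]/(_, _) /= scaler0 addr0.
have [|b0 b0E] := @linear_ex _ N (N' * N)%type (fun x => (0, x)).
  by move=> a x y; rewrite -[RHS]/(_, _) /= scaler0 addr0.
pose j : {linear N' -> P} := qpi Q \o j0.
pose b : {linear N -> P} := qpi Q \o b0.
have inj_j : injective j.
  apply: linear_inj0 => x /qpi_eq0 /QE[d]; rewrite j0E => -[-> /eqP].
  rewrite eq_sym oppr_eq0 => /eqP d0; have -> : d = 0 by apply: val_inj.
  exact: linear0.
have inj_b : injective b.
  apply: linear_inj0 => x /qpi_eq0 /QE[d]; rewrite b0E => -[/esym d0 ->].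
  have -> : d = 0 by apply: inj_i; rewrite d0 linear0.
  by rewrite oppr0.
have [|gP gPE] := @qmod_lift _ _ _ (g \o snd : {linear (N' * N)%type -> W}) Q.
  by move=> _ /QE[d ->]; apply/gE; apply: submodN; apply: valP.
have gPb x : gP (b x) = g x by rewrite /b /= gPE b0E.
have gPj y : gP y = 0 <-> exists x, j x = y.
  have [[x n] <-] := qpi_surj y; rewrite gPE gE; split=> [nD|[x']].
    exists (x + i (Sub n nD)); apply/subr0_eq.
    rewrite -[j _]/(qpi Q (j0 _)) -linearB.
    apply/qpi_eq0/QE; exists (Sub n nD); rewrite j0E.
    by rewrite -[LHS]/(_, _) /= addrC addKr sub0r.
  move=> e; have := gPE (x, n); rewrite -e -[j x']/(qpi Q (j0 x')) gPE j0E /=.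
  by rewrite linear0 => /esym/gE.
have [||E EE] := @submod_ex _ (P * W)%type (fun u => gP u.1 = s *: u.2).
- by rewrite linear0 scaler0.
- by move=> a x y xE yE; rewrite linearP xE yE scalerDr !scalerA mulrC.
have [|k0 k0E] := @linear_ex _ N' (P * W)%type (fun x => (j x, 0)).
  by move=> a x y; rewrite linearP -[RHS]/(_, _) /= scaler0 addr0.
have [|k kE] := @corestrict_ex _ _ _ k0 E.
  by move=> x; apply/EE; rewrite k0E /= scaler0; apply/gPj; exists x.
have [|l0 l0E] := @linear_ex _ N (P * W)%type (fun x => (s *: b x, g x)).
  by move=> a x y; rewrite !linearP.
have [|l lE] := @corestrict_ex _ _ _ l0 E.
  by move=> x; apply/EE; rewrite l0E /= linearZ /= gPb.
have Ek (u : smod E) : (val u).2 = 0 -> exists x, k x = u.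
  move=> u2; have /EE := valP u; rewrite u2 scaler0 => /gPj[x xE].
  by exists x; apply: val_inj; rewrite kE k0E xE -u2; case: (val u).
exists (smod E); split.
- apply: (X_ext (f := k) (g := (snd \o sincl E : {linear smod E -> W}))) => //.
  + by move=> x y /(congr1 val); rewrite !kE !k0E => -[/inj_j].
  (* As [s x = r w] is the image of [r m], scaling the second coordinate by [s] makes [E] map onto
     [W]. *)
  + move=> x; have [r rE] := sW x.
    have xE : (b (r *: m), x) \in E.
      apply/EE; rewrite /= gPb rE; apply: gm; by rewrite subrr rpred0.
    by exists (Sub (b (r *: m), x) xE).
  by move=> u; split=> [/Ek //|[x <-]]; rewrite /= kE k0E.
- move=> t u tp tu.
  have [|x xE] := Ek u.
    by apply: (regW tp); have := congr1 (fun u => (val u).2) tu.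
  rewrite -xE in tu *; have -> : x = 0; last exact: linear0.
  apply: (regN' t) => //; move: tu; rewrite -linearZ => /(congr1 val).
  by rewrite kE k0E => -[]; rewrite -[in RHS](linear0 j) => /inj_j.
exists l; apply: linear_inj0 => x /(congr1 val); rewrite lE l0E => -[sbx /gE xD].
have sx : s *: x = 0 by apply: inj_b; rewrite linearZ linear0.
have : i (Sub x xD) = 0.
  apply: (regN' s) => //; rewrite -linearZ.
  have -> : s *: (Sub x xD : smod D) = 0 by apply: val_inj.
  exact: linear0.
by rewrite -[RHS](linear0 i) => /inj_i /(congr1 val).
Qed.
End EmbedStep.

(** Dévissage reduces to modules with one associated prime [p]; there each added copy of [R/p] is
    absorbed by the rank one module through [embeds_step]. *)
Lemma embed_Ass (M : lmodType R) :
    fin_gen M -> (forall p, Ass M p -> exists2 Z, X Z & Ass Z p) ->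
  exists2 N, X N & exists i : {linear M -> N}, injective i.
Proof.
move=> fgM AssM.
pose T (C : lmodType R) := exists2 N, X N & exists i : {linear C -> N}, injective i.
apply: (@devissage _ noethR T) AssM => //.
- by move=> Z Z0; exists Z; [exact: X_zero | exists (idfun : {linear Z -> Z})].
- move=> A B f inj_f [N XN [i inj_i]]; exists N => //.
  by exists (i \o f : {linear _ -> _}); apply: inj_comp.
- move=> A B [N XN [i inj_i]] [N' XN' [i' inj_i']].
  exists (N * N')%type; first exact: X_prod.
  have [|f fE] := @linear_ex _ (A * B)%type (N * N')%type (fun u => (i u.1, i' u.2)).
    by move=> a x y; rewrite !linearP.
  by exists f => -[x y] [x' y']; rewrite !fE => -[/inj_i -> /inj_i' ->].
move=> p N [Z XZ Zp] fgN AssN.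
have [W [w [XW wE regW [s sp sW]]]] := rank_one_ex XZ Zp.
suff [N' [XN' _ Ni]] : embeds_regular p N by exists N'.
apply: (@coprimary_devissage _ noethR (embeds_regular p)) fgN AssN => //.
- move=> O O0; exists O; split; first exact: X_zero.
    by move=> t x _ _; apply: O0.
  by exists (idfun : {linear O -> O}).
- move=> A B f inj_f [N' [XN' regN' [i inj_i]]]; exists N'; split=> //.
  by exists (i \o f : {linear _ -> _}); apply: inj_comp.
move=> {}N D m _ TD _ Nm pD.
exact: (embeds_step XW wE regW sp sW TD Nm pD).
Qed.
End KEClosed.

(** * Ext groups of a residue field *)

Section FreeResolution.
Variable S : comNzRingType.

Lemma rV_projective k : projective 'rV[S]_k.
Proof.
move=> A B g f g_surj; have /choice[a aE] : forall i, exists a, g a = f (delta_mx 0 i).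
  by move=> i; apply: g_surj.
have [|h hE] := @linear_ex _ 'rV[S]_k A (fun x => \sum_i x 0 i *: a i).
  move=> b x y; rewrite scaler_sumr -big_split /=; apply: eq_bigr => i _.
  by rewrite !mxE scalerDl scalerA.
exists h => x; rewrite hE linear_sum [in RHS](row_sum_delta x) linear_sum.
by apply: eq_bigr => i _; rewrite !linearZ aE.
Qed.

Hypothesis noethS : noetherian S.

Lemma rV_fg k : fin_gen 'rV[S]_k.
Proof.
exists k, (fun i => delta_mx 0 i) => x; exists (fun i => x 0 i).
exact: row_sum_delta.
Qed.

Lemma submod_row_space k (U : submodClosed 'rV[S]_k) :
  exists j (E : 'M[S]_(j, k)), forall x, x \in U <-> exists z, z *m E = x.
Proof.
have [j [h [hU hP]]] := sub_fg noethS U (rV_fg k).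
exists j, (\matrix_i h i) => x; split=> [/hP[c ->]|[z <-]].
  exists (\row_i c i); rewrite mulmx_sum_row; apply: eq_bigr => i _.
  by rewrite rowK mxE.
by rewrite mulmx_sum_row rpred_sum // => i _; rewrite rpredZ // rowK.
Qed.

(** Packing the sizes with the matrix allows a resolution by recursion: the target of [syzygy s] is
    the source of [s]. *)
Record step := Step { src : nat; tgt : nat; stepmx : 'M[S]_(src, tgt) }.

Lemma syzygy_ex (s : step) : exists j (E : 'M[S]_(j, src s)),
  forall x : 'rV_(src s), x *m stepmx s = 0 <-> exists z, z *m E = x.
Proof.
have [||U UE] := @submod_ex _ 'rV[S]_(src s) (fun x => x *m stepmx s = 0).
- exact: mul0mx.
- by move=> a x y x0 y0; rewrite mulmxDl -scalemxAl x0 y0 scaler0 addr0.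
by have [j [E EE]] := submod_row_space U; exists j, E => x; rewrite -UE.
Qed.

Definition syzygy (s : step) : step := Step (sval (cid (svalP (cid (syzygy_ex s))))).

Lemma syzygyP s (x : 'rV_(src s)) :
  x *m stepmx s = 0 <-> exists z, z *m (stepmx (syzygy s) : 'M_(_, src s)) = x.
Proof. exact: (svalP (cid (svalP (cid (syzygy_ex s))))). Qed.

Variable m : idealr S.
Local Open Scope quotient_scope.

Lemma residue_eq0 a : (\pi_{ideal_quot m} a = 0) <-> a \in m.
Proof.
have E := Quotient.idealrBE m a 0; rewrite subr0 rmorph0 in E.
by rewrite E; split=> [->|/eqP].
Qed.

Definition residue_pi (a : S^o) : residue m := \pi_{ideal_quot m} a.

Fact residue_pi_linear : linear residue_pi.
Proof.
move=> a x y; rewrite /residue_pi rmorphD; congr (_ + _).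
by rewrite -[RHS]/(\pi_{ideal_quot m} a * \pi_{ideal_quot m} x) -rmorphM.
Qed.
HB.instance Definition _ :=
  GRing.isLinear.Build S S^o (residue m) _ residue_pi residue_pi_linear.

Lemma residue_pi_surj y : exists x, residue_pi x = y.
Proof. by exists (repr y); rewrite /residue_pi reprK. Qed.

(** In this resolution [P 0] is free of rank one on [u], [phi] is its coordinate, and the first
    differential has image [m]. Cocycles of low degree can then be written through [S] and [m]. *)
Lemma residue_resolution : exists (P : proj_resolution (residue m))
    (phi : {linear P 0 -> S^o}) (u : P 0),
  phi u = 1 /\ forall x, phi x \in m <-> exists z, res_diff P 0 z = x.
Proof.
have [||U0 U0E] := @submod_ex _ 'rV[S]_1 (fun x => x 0 0 \in m).
- by rewrite mxE rpred0.
- by move=> a x y xm ym; rewrite !mxE rpredD ?idealMr.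
have [j [E EE]] := submod_row_space U0.
(* The rows of [E] generate [m]; each later matrix generates the relations among the rows of the
   previous one. *)
pose st := fix st n := if n is n'.+1 then syzygy (st n') else Step E.
pose P n : lmodType S := 'rV[S]_(tgt (st n)).
pose d n : {linear P n.+1 -> P n} := mulmxr (stepmx (st n)).
have [|phi phiE] := @linear_ex _ (P 0%N) S^o (fun x => x 0 0).
  by move=> a x y; rewrite !mxE.
pose aug : {linear P 0%N -> residue m} := residue_pi \o phi.
have aug_surj y : exists x, aug x = y.
  have [x <-] := residue_pi_surj y; exists (const_mx x).
  by rewrite /aug /= phiE mxE.
have exact0 x : aug x = 0 <-> exists z, d 0%N z = x.
  by rewrite -[exists z, _]EE U0E -residue_eq0 /aug /= phiE.
have exactS n x : d n x = 0 <-> exists z, d n.+1 z = x.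
  exact: syzygyP.
exists (@ProjResolution _ _ P d aug (fun n => @rV_projective _) aug_surj exact0 exactS).
exists phi, (const_mx 1); split=> [|x]; first by rewrite phiE mxE.
by rewrite phiE -U0E EE.
Qed.
End FreeResolution.

(** * Degrees zero and one *)

Section ResidueExt.
Variables (S : comNzRingType) (m : idealr S) (N : lmodType S).
Hypothesis noethS : noetherian S.

Lemma depth_leP n :
  depth_le (depth m N) n <-> exists2 i, (i <= n)%N & ext_neq0 i (residue m) N.
Proof.
rewrite /depth; case: pselect => [e|ne] /=; last first.
  by split=> // -[i _ /asboolP iP]; case: ne; exists i.
case: ex_minnP => i /asboolP iP imin; split=> [le_in|[j le_jn /asboolP/imin le_ij]].
  by exists i.
exact: leq_trans le_ij le_jn.
Qed.

(** Ext^0(k, N) is Hom(k, N). From left to right the resolution is arbitrary: [r x] is a boundary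
    for [r] in [m], so [m] kills the values of a cocycle. The converse may choose
    [residue_resolution]. *)
Lemma ext0_residue :
  ext_neq0 0 (residue m) N <-> exists2 x : N, x <> 0 & forall r, r \in m -> r *: x = 0.
Proof.
split=> [[P [f [fd f0]]]|[x x0 xm]].
  have /existsNP[x fx] := f0; exists (f x) => // r rm.
  have /res_exact0[z zE] : res_aug P (r *: x) = 0.
    rewrite linearZ /=; have /residue_eq0 r0 := rm.
    by rewrite -[LHS]/(_ * _) r0 mul0r.
  by rewrite -linearZ -zE; apply: fd.
have [P [phi [u [phiu phiP]]]] := residue_resolution noethS m.
have [|f fE] := @linear_ex _ (P 0%N) N (fun y => phi y *: x).
  by move=> a y z; rewrite linearP scalerDl -scalerA.
exists P, f; split=> [z|/(_ u)]; last by rewrite fE phiu scale1r.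
by rewrite fE; apply/xm/phiP; exists z.
Qed.

(** A linear map from [m] to [N], encoded as a function on [S] with unconstrained values outside
    [m]. *)
Definition linear_on (g : S -> N) :=
  forall a x y, x \in m -> y \in m -> g (a * x + y) = a *: g x + g y.

Lemma linear_on0 g : linear_on g -> g 0 = 0.
Proof.
move=> gP; have := gP (-1) 0 0 (idealr0 m) (idealr0 m).
by rewrite mulr0 addr0 scaleN1r addNr.
Qed.

Lemma linear_on_sum g n (c x : 'I_n -> S) : linear_on g ->
  (forall i, x i \in m) -> g (\sum_i c i * x i) = \sum_i c i *: g (x i).
Proof.
move=> gP xm; elim: n c x xm => [|n IHn] c x xm; first by rewrite !big_ord0 linear_on0.
rewrite !big_ord_recl gP ?IHn // rpred_sum // => i _.
exact: idealMr.
Qed.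

(** The sequence [0 -> m -> S -> k -> 0] identifies Ext^1(k, N) with the cokernel of
    [N -> Hom(m, N)]. *)
Lemma ext1_residue :
  ext_neq0 1 (residue m) N <-> exists2 g, linear_on g &
    ~ exists xi, forall r, r \in m -> g r = r *: xi.
Proof.
split=> [[P [f [fd f0]]]|[g gP g0]]; last first.
  have [P [phi [u [phiu phiP]]]] := residue_resolution noethS m.
  have dm z : phi (res_diff P 0 z) \in m by apply/phiP; exists z.
  have [|f fE] := @linear_ex _ (P 1%N) N (fun z => g (phi (res_diff P 0 z))).
    by move=> a x y; rewrite !linearP gP.
  exists P, f; split=> [z|[h hE]].
    rewrite fE; have -> : res_diff P 0 (res_diff P 1 z) = 0 by apply/res_exact; exists z.
    by rewrite linear0 linear_on0.
  apply: g0; exists (h u) => r rm.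
  have phir : phi (r *: u) = r by rewrite linearZ /= phiu; apply: mulr1.
  have /phiP[z zE] : phi (r *: u) \in m by rewrite phir.
  by rewrite -linearZ -zE -hE fE zE phir.
(* [a] compares an arbitrary resolution with [S] by lifting the augmentation through [S -> k]. *)
have [a aE] := @res_proj _ _ P 0%N _ _ (@residue_pi S m) (res_aug P)
  (@residue_pi_surj S m).
have [u uE] := res_aug_surj P 1.
(* [c] picks preimages under the differential; a cocycle does not see the choice, so [f \o c] is
   linear on the kernel of the augmentation. *)
have /choice[c cP] : forall x, exists z, res_aug P x = 0 -> res_diff P 0 z = x.
  move=> x; have [/res_exact0[z zE]|x0] := pselect (res_aug P x = 0); first by exists z.
  by exists 0.
have fc z : f (c (res_diff P 0 z)) = f z.
  apply/subr0_eq; rewrite -linearB.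
  have /res_exact[y <-] : res_diff P 0 (c (res_diff P 0 z) - z) = 0.
    by rewrite linearB cP ?subrr //; apply/res_exact0; exists z.
  exact: fd.
have fcP b x y : res_aug P x = 0 -> res_aug P y = 0 ->
    f (c (b *: x + y)) = b *: f (c x) + f (c y).
  move=> /res_exact0[z <-] /res_exact0[t <-].
  by rewrite -linearP !fc linearP.
have augu r : r \in m -> res_aug P (r *: u) = 0.
  by move=> rm; rewrite linearZ /= uE -[LHS]/(_ * _) mulr1; apply/residue_eq0.
exists (fun r => f (c (r *: u))).
  by move=> b x y xm ym; rewrite scalerDl -scalerA fcP ?augu.
move=> [xi xiE]; apply: f0.
have augK x : res_aug P (x - a x *: u) = 0.
  rewrite linearB linearZ /= uE -[X in _ - X]/(_ * _) mulr1.
  by rewrite -aE; apply: subrr.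
(* [h] extends [f \o c] from the kernel of the augmentation to [P 0], with [xi] as its value along
   [u]; this makes [f] a coboundary. *)
have [|h hE] := @linear_ex _ (P 0%N) N (fun x => f (c (x - a x *: u)) + a x *: xi).
  move=> b x y.
  have -> : b *: x + y - a (b *: x + y) *: u = b *: (x - a x *: u) + (y - a y *: u).
    by rewrite linearP scalerDl -scalerA opprD addrACA scalerBr.
  by rewrite fcP // linearP scalerDl scalerDr -[(_ *: a x) *: xi]scalerA addrACA.
exists h => z; rewrite hE.
have am : a (res_diff P 0 z) \in m.
  have : residue_pi m (a (res_diff P 0 z)) = 0 by rewrite aE; apply/res_exact0; exists z.
  by move/residue_eq0.
rewrite -xiE // addrC.
have -> : res_diff P 0 z - a (res_diff P 0 z) *: u =
    (-1) *: (a (res_diff P 0 z) *: u) + res_diff P 0 z by rewrite scaleN1r addrC.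
rewrite fcP ?augu //; last by apply/res_exact0; exists z.
by rewrite scaleN1r addrA subrr add0r fc.
Qed.
End ResidueExt.

(** * Localization *)

Section Localization.
Variables (R : comPzRingType) (p : spec R).
Local Notation Rp := (loc_ring p).

Definition to_loc (M : lmodType R) (x : M) : loc_mod p M := loc_frac x denom1.

Section Module.
Variable M : lmodType R.
Implicit Types x y : M.

Lemma loc_fracZ (a : R) s x t :
  loc_ring_frac a s *: loc_frac x t = loc_frac (a *: x) (denomM s t) :> loc_mod p M.
Proof. exact: loc_scaleE. Qed.

Lemma loc_frac_eq0 x s :
  loc_frac x s = 0 :> loc_mod p M <-> exists2 u, u \notin p & u *: x = 0.
Proof.
rewrite -[0]/(loc_zero p M) /loc_zero; split=> [/loc_fracP[u]|[u up ux]].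
  by rewrite scaler0 mulr1 => ux; exists (sval u); first exact: (svalP u).
by apply/loc_fracP; exists (exist _ u up); rewrite /= scaler0 mulr1.
Qed.

Lemma to_locD x y : to_loc (x + y) = to_loc x + to_loc y.
Proof.
by rewrite /to_loc loc_fracD; apply/loc_fracP; exists denom1; rewrite /= !mulr1 !scale1r.
Qed.

Lemma to_loc_sum n (F : 'I_n -> M) : to_loc (\sum_i F i) = \sum_i to_loc (F i).
Proof.
apply: (big_morph (@to_loc M)) => [x y|]; first exact: to_locD.
by apply/loc_frac_eq0; exists 1; rewrite ?spec1 ?scaler0.
Qed.

Lemma loc_frac_to_loc (a : R) s x :
  loc_ring_frac a s *: to_loc x = loc_frac (a *: x) s.
Proof.
by rewrite loc_fracZ; apply/loc_fracP; exists denom1 => /=; rewrite mulr1.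
Qed.

Lemma to_locZ (a : R) x : to_loc (a *: x) = loc_ring_frac a denom1 *: to_loc x.
Proof. by rewrite loc_frac_to_loc. Qed.

Lemma loc_fracE x s : loc_frac x s = loc_ring_frac 1 s *: to_loc x.
Proof. by rewrite loc_frac_to_loc scale1r. Qed.

End Module.

Lemma loc_ring_fracM (a b : R) s t :
  loc_ring_frac a s * loc_ring_frac b t = loc_ring_frac (a * b) (denomM s t) :> Rp.
Proof. exact: loc_scaleE. Qed.

Lemma loc_ring_frac1 (s : denom p) : loc_ring_frac (sval s) s = 1.
Proof.
apply/loc_fracP; exists denom1.
by rewrite /= !regular_scaleE; ring.
Qed.

Lemma loc_ring_sum n (c a : 'I_n -> R) s :
  loc_ring_frac (\sum_i c i * a i) s =
  \sum_i loc_ring_frac (c i) s * loc_ring_frac (a i) denom1 :> Rp.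
Proof.
rewrite [LHS](loc_fracE (M := R^o)) (to_loc_sum (M := R^o)) scaler_sumr.
apply: eq_bigr => i _; rewrite loc_frac_to_loc scale1r.
apply: esym; exact: (loc_frac_to_loc (M := R^o)).
Qed.

Lemma loc_noetherian : noetherian R -> noetherian Rp.
Proof.
move=> noethR I [I0 ID IM].
have [|a b aI bI|a b bI|J [idJ JE]] :=
  @ideal_ex R (fun a => loc_ring_frac a denom1 \in I).
- by have -> : loc_ring_frac 0 denom1 = 0 :> Rp by [].
- have -> : loc_ring_frac (a + b) denom1 =
      loc_ring_frac a denom1 + loc_ring_frac b denom1 :> Rp.
    exact: (to_locD (M := R^o)).
  exact: ID.
- have -> : loc_ring_frac (a * b) denom1 =
      loc_ring_frac a denom1 * loc_ring_frac b denom1 :> Rp.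
    by apply/esym; apply: (loc_frac_to_loc (M := R^o)).
  exact: IM.
have [n [g [gJ gP]]] := noethR _ idJ.
exists n, (fun i => loc_ring_frac (g i) denom1); split=> [i|]; first exact/JE.
elim/loc_fracW => a s asI.
have /gP[c aE] : a \in J.
  apply/JE; have := IM (loc_ring_frac (sval s) denom1) _ asI.
  rewrite loc_ring_fracM; congr (_ \in I); apply/loc_fracP; exists denom1.
  by rewrite /= !regular_scaleE; ring.
by exists (fun i => loc_ring_frac (c i) s); rewrite -loc_ring_sum -aE.
Qed.

Lemma loc_max_frac0 (a : R) s : (loc_ring_frac a s \in loc_max p) = (a \in p).
Proof. exact: loc_max_frac. Qed.

Lemma loc_map_ex (M N : lmodType R) (f : {linear M -> N}) :
  exists g : {linear loc_mod p M -> loc_mod p N},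
    forall x s, g (loc_frac x s) = loc_frac (f x) s.
Proof.
pose g (z : loc_mod p M) : loc_mod p N := loc_frac (f (repr z).1) (repr z).2.
have gE x s : g (loc_frac x s) = loc_frac (f x) s.
  have /loc_fracP[u e] := loc_frac_repr (loc_frac x s).
  by apply/loc_fracP; exists u; rewrite -!linearZ e.
have [|h hE] := @linear_ex _ _ _ g; last by exists h => x s; rewrite hE gE.
have fZ b v : f (b *: v) = b *: f v by exact: linearZ.
elim/loc_fracW=> a r; elim/loc_fracW=> x s; elim/loc_fracW=> y t.
by rewrite loc_fracZ loc_fracD !gE loc_fracZ loc_fracD linearD !fZ.
Qed.

Hypothesis noethR : noetherian R.

Lemma spec_fg : exists n (a : 'I_n -> R), (forall i, a i \in p) /\
  forall x, x \in p -> exists c : 'I_n -> R, x = \sum_i c i * a i.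
Proof. by have [idp _ _] := specP p; apply: noethR. Qed.

(** If the maximal ideal kills [x / t], a common denominator [s] makes [p] kill [s x]; nothing
    outside [p] does, as the fraction is nonzero. *)
Lemma Ass_loc (M : lmodType R) : Ass M p <->
  exists2 x : loc_mod p M, x <> 0 & forall r, r \in loc_max p -> r *: x = 0.
Proof.
split=> [[x xE]|[z]].
  exists (to_loc x) => [/loc_frac_eq0[u /negP up /xE]//|].
  elim/loc_fracW=> a s; rewrite loc_max_frac0 => /xE ax.
  by rewrite loc_frac_to_loc ax; apply/loc_frac_eq0; exists 1; rewrite ?spec1 ?scaler0.
elim/loc_fracW: z => x t x0 px.
have [||A AE] := @submod_ex _ R^o (fun a : R => a *: x = 0).
- by rewrite scale0r.
- by move=> a b c bx cx; rewrite scalerDl cx addr0 -(scalerA a b) bx scaler0.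
have [||P PE] := @submod_ex _ R^o (fun a : R => a \in p).
- exact: spec0.
- by move=> a b c bp cp; apply: specD => //; apply: specMr.
have [|a /PE ap|s sp sP] := @common_denom _ noethR p R^o P A.
- exact: regular_fg.
- have := px (loc_ring_frac (a : R) denom1); rewrite loc_max_frac0 => /(_ ap).
  rewrite loc_fracZ => /loc_frac_eq0[u up ux]; exists u => //.
  by apply/AE; rewrite -ux scalerA.
exists (s *: x) => r; split=> [rp|rx].
  have /sP/AE : (r : R^o) \in P by apply/PE.
  by move=> srx; rewrite scalerA mulrC.
apply: contrapT => /negP rp; apply: x0; apply/loc_frac_eq0.
by exists (r * s); [apply: specMN | rewrite -scalerA].
Qed.

Lemma A_mod0 (M : lmodType R) : A_mod 0 M p <-> Ass M p.
Proof.
rewrite /A_mod depth_leP Ass_loc -(ext0_residue _ _ (loc_noetherian noethR)).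
by split=> [[i]|e]; [rewrite leqn0 => /eqP -> | exists 0%N].
Qed.

(** Nonvanishing of Ext^1 from the residue field to [M_p], in the form of [ext1_residue]. *)
Definition ext1_nontrivial (M : lmodType R) :=
  exists2 g, linear_on (loc_max p) (N := loc_mod p M) g &
    ~ exists xi, forall r, r \in loc_max p -> g r = r *: xi.

Lemma A_mod1 (M : lmodType R) : A_mod 1 M p <-> Ass M p \/ ext1_nontrivial M.
Proof.
have noethRp := loc_noetherian noethR.
rewrite /A_mod depth_leP Ass_loc -(ext0_residue _ _ noethRp).
rewrite /ext1_nontrivial -(ext1_residue _ _ noethRp).
split=> [[[|[|//]]]|[e|e]]; [by left | by right | by exists 0%N | by exists 1%N].
Qed.

(** Multiplication by [x] maps the maximal ideal of [R_p] into [M_p]. Were it multiplication by some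
    [xi] in [M_p], then [x - xi] would be killed by that ideal, hence zero if [p] is not in Ass N,
    and a denominator outside [p] would carry [x] into [M]. *)
Lemma A_mod1_sub (M N : lmodType R) (i : {linear M -> N}) (x : N) :
    injective i -> (forall r, r \in p <-> exists y, i y = r *: x) ->
  Ass N p \/ A_mod 1 M p.
Proof.
move=> inj_i xE; have [|NA] := pselect (Ass N p); first by left.
right; apply/A_mod1; right; have [j jE] := loc_map_ex i.
have inj_j : injective j.
  apply: linear_inj0; elim/loc_fracW=> y s; rewrite jE.
  move=> /loc_frac_eq0[u up]; rewrite -linearZ -(linear0 i) => /inj_i uy.
  by apply/loc_frac_eq0; exists u.
have /choice[g gE] : forall r, exists y, r \in loc_max p -> j y = r *: to_loc x.
  elim/loc_fracW=> a s; rewrite loc_max_frac0.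
  have [ap|ap] := boolP (a \in p); last by exists 0.
  have /xE[y yE] := ap; exists (loc_frac y s) => _.
  by rewrite jE yE -loc_frac_to_loc.
exists g => [a r s rm sm|[]].
  have arm : a * r \in loc_max p by apply: idealMr.
  by apply: inj_j; rewrite linearP !gE ?rpredD // scalerDl scalerA.
elim/loc_fracW=> y t xiE; apply: NA; apply/Ass_loc.
exists (to_loc x - j (loc_frac y t)); last first.
  by move=> r rm; rewrite scalerBr -linearZ -xiE // gE // subrr.
move/subr0_eq; rewrite jE => /loc_fracP[u e].
have : sval u * sval t \in p.
  by apply/xE; exists (sval u *: y); rewrite linearZ e mulr1.
by apply/negP; apply: specMN; [exact: (svalP u) | exact: (svalP t)].
Qed.

End Localization.

(** * Primes of depth at most one *)

Section KEClosedDepth.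
Variables (R : comPzRingType) (noethR : noetherian R).
Variables (X : mod_class R) (KE_X : KE_closed X).

Lemma relations_ex (M : lmodType R) n (v : 'I_n -> M) :
  exists K : submodClosed {ffun 'I_n -> R^o},
    forall c, c \in K <-> \sum_i c i *: v i = 0.
Proof.
apply: submod_ex => [|b c d c0 d0].
  by apply: big1 => i _; rewrite ffunE scale0r.
transitivity (b *: (\sum_i c i *: v i) + \sum_i d i *: v i); last first.
  by rewrite c0 d0 scaler0 addr0.
rewrite scaler_sumr -big_split; apply: eq_bigr => i _.
by rewrite !ffunE /= scalerDl -(scalerA b (c i)).
Qed.

Lemma ffun_fg n : fin_gen {ffun 'I_n -> R^o}.
Proof.
exists n, (fun i => [ffun j => (i == j)%:R : R^o]) => x; exists x.
apply/ffunP => j; rewrite sum_ffunE (bigD1 j) //= big1 => [|i ij].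
  by rewrite !ffunE eqxx addr0 /GRing.scale /= mulr1.
by rewrite !ffunE (negPf ij) scaler0.
Qed.

(* [H] is [Hom(I, L)] for the ideal [I] generated by the [a i], a morphism being
   given by the images of these generators. *)
Lemma X_hom (L : lmodType R) n (a : 'I_n -> R) : X L ->
  exists2 H : submodClosed {ffun 'I_n -> L}, X (smod H) &
    forall h, h \in H <-> forall c : 'I_n -> R,
      \sum_i c i * a i = 0 -> \sum_i c i *: h i = 0.
Proof.
move=> XL; have [K KE] := @relations_ex R^o n a.
have [k [r [rK rP]]] := sub_fg noethR K (@ffun_fg n).
have [|f fE] := @linear_ex _ {ffun 'I_n -> L} {ffun 'I_k -> L}
    (fun h => [ffun j => \sum_i r j i *: h i]).
  move=> b x y; apply/ffunP => j; rewrite !ffunE scaler_sumr -big_split /=.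
  apply: eq_bigr => i _; rewrite !ffunE scalerDr !scalerA.
  by rewrite mulrC.
have [||H HE] := @submod_ex _ {ffun 'I_n -> L} (fun h => f h = 0).
- exact: linear0.
- by move=> b x y x0 y0; rewrite linearP x0 y0 scaler0 addr0.
exists H.
  exact: (target_ker HE (X_ffun KE_X n XL) (target_X KE_X (X_ffun KE_X k XL))).
move=> h; rewrite HE fE; split=> [/ffunP h0 c c0|h0]; last first.
  by apply/ffunP => j; rewrite !ffunE; apply: h0; apply/KE.
have /rP[d cE] : [ffun i => c i : R^o] \in K.
  by apply/KE; rewrite -[RHS]c0; apply: eq_bigr => i _; rewrite ffunE.
have ci i : c i = \sum_j d j * r j i.
  move/ffunP/(_ i): cE; rewrite ffunE sum_ffunE => ->.
  by apply: eq_bigr => j _; rewrite ffunE.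
under eq_bigr => i _ do rewrite ci scaler_suml.
rewrite exchange_big big1 // => j _; have := h0 j; rewrite !ffunE.
under [in X in _ -> X]eq_bigr => i _ do rewrite -scalerA.
by rewrite -scaler_sumr => ->; rewrite scaler0.
Qed.

(** Otherwise [M/L] has an associated prime [q] inside [p]. It is the annihilator of an element of
    [U], so it contains [p], and [p = q] would be associated to [M]. *)
Lemma coprime_saturation (p : spec R) (M : lmodType R) (U L : submodClosed M) :
    ~ Ass M p -> (forall x, x \in U -> forall a, a \in p -> a *: x = 0) ->
    (forall (q : spec R) x, (forall r, r \in q <-> r *: x \in L) ->
       exists b, b \in U /\ forall r, r \in q <-> r *: b = 0) ->
  forall x, exists2 s, s \notin p & s *: x \in L.
Proof.
move=> NA pU AssL x; apply: contrapT => h.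
have [|||r [q [qE qp]]] :=
  @Ass_ex _ noethR (qmod L) (fun s => s \notin p) (qpi L x).
- exact: spec1.
- exact: specMN.
- by move=> s sp; rewrite -linearZ => /qpi_eq0 sx; apply: h; exists s.
have [|b [bU bE]] := AssL q (r *: x).
  by move=> t; rewrite qE -(qpiZ L r x) -(qpiZ L t) qpi_eq0.
apply: NA; exists b => t; split=> [tp|/bE tq]; first exact: pU tp.
by apply: contrapT => /negP /qp; rewrite tq.
Qed.

Lemma target_prime_A1 (p : spec R) (M : lmodType R) :
  X M -> A_mod 1 M p -> target_prime X p.
Proof.
move=> XM /(A_mod1 p noethR) M1; have [|NA] := pselect (Ass M p).
  by move=> Mp; apply: (target_prime_X KE_X XM Mp).
have [//|[g gP g0]] := M1.
have [n [a [ap aP]]] := spec_fg p noethR.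
have [U _ UE] := X_annihilated noethR KE_X p XM.
have [O OE] := zero_submod M.
have fgM : fin_gen M by case: KE_X => -[h _] _ _ _; apply: h.
(* [L] is maximal with zero intersection with [U], so Hom(R/p, L) vanishes, while [L] and [M] agree
   at [p]. *)
have [|L [_ LU _ AssL]] :=
  complement noethR (L := O) (A := O) (B := U) fgM (fun _ h => h).
  by move=> x.
have {}AssL (q : spec R) x : (forall r, r \in q <-> r *: x \in L) ->
    exists b, b \in U /\ forall r, r \in q <-> r *: b = 0.
  by move/AssL => [b [bU bE]]; exists b; split=> // r; rewrite bE OE.
have XL : X (smod L).
  apply: (X_sub noethR KE_X XM) => q /Ass_qmod[x /AssL[b [_ bE]]].
  by apply: (target_prime_X KE_X XM); exists b.
have satL := coprime_saturation NA (fun x => proj1 (UE x)) AssL.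
pose g_ i := g (loc_ring_frac (a i) denom1).
have [t tp tP] : exists2 t, t \notin p & forall i, exists l : smod L,
    loc_ring_frac t denom1 *: g_ i = to_loc p (val l).
  have /choice[t tP] : forall i, exists t, t \notin p /\ exists l : smod L,
      loc_ring_frac t denom1 *: g_ i = to_loc p (val l).
    move=> i; move: (g_ i); elim/loc_fracW => y u; have [s sp sy] := satL y.
    exists (sval u * s); split; first by apply: specMN => //; apply: (svalP u).
    exists (Sub (s *: y) sy); rewrite loc_fracZ; apply/loc_fracP; exists denom1.
    by rewrite /= !scalerA; congr (_ *: _); ring.
  exists (\prod_i t i); first by apply: spec_prod => i; case: (tP i).
  move=> i; have [_ [l lE]] := tP i.
  rewrite (bigD1 i) //=; set b := \prod_(j < n | _) _.
  exists (b *: l); rewrite -[val _]/(b *: val l) to_locZ -lE scalerA.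
  rewrite loc_ring_fracM mulrC; congr (_ *: _); apply/loc_fracP.
  by exists denom1; rewrite /= !mulr1.
have {tP} /choice[l lP] := tP.
have [K KE] := @relations_ex R^o n a.
have [K' K'E] := relations_ex l.
(* Relations among the [a i] hold for the [l i] only after localization; one [s] repairs them all,
   so [s *: l i] defines a map from [p] to [L]. *)
have [|s sp sK] := @common_denom _ noethR p _ K K' (@ffun_fg n).
  move=> c /KE c0.
  have : to_loc p (\sum_i c i *: val (l i)) = 0.
    rewrite to_loc_sum.
    transitivity
      (loc_ring_frac t denom1 *: \sum_i loc_ring_frac (c i : R) denom1 *: g_ i).
      rewrite scaler_sumr; apply: eq_bigr => i _.
      rewrite scalerA mulrC -scalerA lP.
      exact: to_locZ.
    rewrite -(linear_on_sum _ gP) => [|i]; last by rewrite loc_max_frac0.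
    rewrite -loc_ring_sum; have -> : \sum_i c i * a i = 0 := c0.
    by rewrite (linear_on0 gP) scaler0.
  move=> /loc_frac_eq0[s sp s0]; exists s => //; apply/K'E.
  apply: val_inj; rewrite -[LHS]/(sincl L _) linear_sum -[RHS]s0 scaler_sumr.
  by apply: eq_bigr => i _; rewrite ffunE /= scalerA.
have [H XH HE] := X_hom a XL.
have [|j0 j0E] := @linear_ex _ (smod L) {ffun 'I_n -> smod L}
    (fun x => [ffun i => a i *: x]).
  by move=> b x y; apply/ffunP => i; rewrite !ffunE scalerDr !scalerA mulrC.
have [|j jE] := @corestrict_ex _ _ _ j0 H.
  move=> x; apply/HE => c c0; rewrite -[RHS](scale0r x) -c0 scaler_suml.
  by apply: eq_bigr => i _; rewrite j0E ffunE scalerA.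
have inj_j : injective j.
  apply: linear_inj0 => x /(congr1 val); rewrite jE j0E => /ffunP x0.
  apply: val_inj; apply/OE/LU; first exact: valP.
  apply/UE => b /aP[c ->]; rewrite scaler_suml big1 // => i _.
  rewrite -scalerA; have := x0 i; rewrite !ffunE => /(congr1 val) /= ->.
  exact: scaler0.
have [||I IE] := @submod_ex _ (smod H) (fun h => exists x, j x = h).
- by exists 0; apply: linear0.
- by move=> b _ _ [x <-] [y <-]; exists (b *: x + y); rewrite linearP.
pose h0 : {ffun 'I_n -> smod L} := [ffun i => s *: l i].
have h0H : h0 \in H.
  apply/HE => c c0; have /sK/K'E sc0 : [ffun i => c i : R^o] \in K.
    by apply/KE; rewrite -[RHS]c0; apply: eq_bigr => i _; rewrite ffunE.
  rewrite -[RHS]sc0; apply: eq_bigr => i _; rewrite !ffunE scalerA mulrC.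
  by [].
exists (qmod I).
  apply: (target_coker KE_X inj_j (qpi_surj (U := I))) => // h.
  by rewrite qpi_eq0 IE.
apply/Ass_qmod; exists (Sub h0 h0H) => r; rewrite IE; split=> [rp|[x xE]].
  have [d rE] := aP r rp; exists (\sum_k d k *: h0 k).
  apply: val_inj; rewrite jE j0E; apply/ffunP => i.
  rewrite !ffunE -[s *: l i](ffunE (fun i => s *: l i)) -/h0.
  (* Writing [r] as the combination of the [a k] with coefficients [d k], the vector [r e_i - a i d]
     is a relation among the [a k]. As [h0] respects it, [r *: h0] is the image of the sum of the
     [d k *: h0 k]. *)
  apply/esym/subr0_eq; have /HE := h0H => /(_ (fun k => r * (k == i)%:R - a i * d k)).
  have -> F : \sum_k (r * (k == i)%:R - a i * d k) *: (F k : smod L) =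
      r *: F i - a i *: \sum_k d k *: F k.
    rewrite scaler_sumr; under eq_bigr => k _ do rewrite scalerBl -[(a i * _) *: _]scalerA.
    rewrite sumrB (bigD1 i) //= eqxx mulr1 big1 ?addr0 // => k ki.
    by rewrite (negPf ki) mulr0 scale0r.
  apply; rewrite (eq_bigr (fun k => r * (k == i)%:R * a k - a i * (d k * a k))).
    rewrite sumrB -mulr_sumr -rE (bigD1 i) //= eqxx mulr1 big1 ?addr0 => [|k ki].
      by rewrite mulrC subrr.
    by rewrite (negPf ki) mulr0 mul0r.
  by move=> k _; rewrite mulrBl mulrA.
(* If [r] outside [p] carried [h0] to the image of [x], then [g] would be multiplication by
   [x / (r s t)]. *)
apply: contrapT => /negP rp; apply: g0.
have up : r * s * t \notin p by rewrite !specMN.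
pose u : denom p := exist _ (r * s * t) up.
exists (loc_frac (val x) u).
have ga i : g_ i = loc_ring_frac (a i) denom1 *: loc_frac (val x) u.
  transitivity (loc_ring_frac (sval u) u *: g_ i); first by rewrite loc_ring_frac1 scale1r.
  have -> : loc_ring_frac (sval u) u =
      loc_ring_frac (r * s) u * loc_ring_frac t denom1.
    by rewrite loc_ring_fracM; apply/loc_fracP; exists denom1; rewrite /= mulr1.
  rewrite -scalerA lP loc_frac_to_loc loc_fracZ.
  have -> : (r * s) *: val (l i) = a i *: val x.
    move/(congr1 val)/ffunP/(_ i)/(congr1 val): xE; rewrite jE j0E ffunE /= => ->.
    by rewrite !ffunE /= scalerA.
  by apply/loc_fracP; exists denom1; rewrite /= mul1r.
elim/loc_fracW => b v; rewrite loc_max_frac0 => /aP[c ->].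
rewrite -[loc_frac _ _]/(loc_ring_frac _ _) loc_ring_sum.
rewrite (linear_on_sum _ gP) => [|i]; last by rewrite loc_max_frac0.
rewrite scaler_suml; apply: eq_bigr => i _.
by rewrite -scalerA -ga.
Qed.
End KEClosedDepth.

(** * From embeddings and targets to the equality of subcategories *)

Theorem theorem5p14 (R : comPzRingType) (X : mod_class R) :
  noetherian R -> KE_closed X ->
  forall M : lmodType R,
    X M <-> mod_ass (A_class 0 X) M /\ mod_depth 1 (A_class 1 X) M.
Proof.
move=> noethR KE_X M; split=> [XM|[[fgM AssM] [_ A1M]]].
  have fgM : fin_gen M by case: KE_X => -[h _] _ _ _; apply: h.
  split; split=> // p pM; exists M; split=> //.
  exact/(A_mod0 _ noethR).
have AssX p : Ass M p -> exists2 Z, X Z & Ass Z p.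
  by move=> /AssM[Z [XZ /(A_mod0 _ noethR) Zp]]; exists Z.
have [N XN [i inj_i]] := embed_Ass noethR KE_X fgM AssX.
have [||U UE] := @submod_ex _ N (fun y => exists x, i x = y).
- by exists 0; apply: linear0.
- by move=> b _ _ [x <-] [y <-]; exists (b *: x + y); rewrite linearP.
have fgN : fin_gen N by case: KE_X => -[h _] _ _ _; apply: h.
suff YU : target X (qmod U).
  by apply: (YU _ _ (qpi U) i) XN => // y; rewrite qpi_eq0 UE.
apply: (target_Ass noethR KE_X) => [|p /Ass_qmod[x xE]].
  exact: surj_fg (qpi_surj (U := U)) fgN.
have [|Np|/A1M[Z [XZ Z1]]] := A_mod1_sub noethR inj_i (p := p) (x := x).
- by move=> r; rewrite xE UE.
- exact: (target_prime_X KE_X XN Np).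
exact: target_prime_A1 XZ Z1.
Qed.
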